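(* For any constant $K$ let $S_K=\{\theta:\ \|\theta\|_{W^{1,4}}^4+\|\theta\|_{H^{3/2}}^2\ge K\}$. Then there is $\theta_0\in S_K$ such that the solution of the SQG equation $\theta_t+\mathbf u\cdot\nabla\theta=0$ with $\theta(0)=\theta_0$ is global. More generally, there exists a sequence $(a_j)_{j\ge1}$ with $A_0=\sum_ja_j^2<\infty$ such that the invariant measure $\mu$ of the SQG equation associated with the noise coefficients $(a_j)$ (an accumulation point as $\alpha\to0$ of the stationary measures $\mu_\alpha$, see context) satisfies $\mu(S_K)>0$.
   Context: $\mathbb T^2$ is the flat two-dimensional torus; all functions on it are real-valued with zero mean. $(e_j)_{j\ge1}$ is an $L^2$-orthonormal basis of (zero-mean) eigenfunctions of $-\Delta$ with eigenvalues $0<\lambda_1\le\lambda_2\le\dots$, and $A_s=\sum_j\lambda_j^sa_j^2$. $\|\cdot\|$ is the $L^2(\mathbb T^2)$ norm, $\|\theta\|_{H^s}=\|(-\Delta)^{s/2}\theta\|$, $\|\theta\|_{W^{1,4}}=\|\nabla\theta\|_{L^4}$. The velocity is $\mathbf u=(-\partial_y,\partial_x)(-\Delta)^{-1/2}\theta$. A global solution is a function in $C(\mathbb R^+,H^1)\cap L^2_{loc}(\mathbb R^+,H^2)$ satisfying $\theta(t)=\theta_0-\int_0^t\mathbf u\cdot\nabla\theta\,ds$ in $L^2$ for all $t\ge0$. The stochastic SQG equation with parameter $\alpha\in(0,1)$ is $d\theta+\mathbf u\cdot\nabla\theta\,dt=-\alpha\Delta^2\theta\,dt+\alpha\nabla\cdot(|\nabla\theta|^2\nabla\theta)\,dt+\sqrt\alpha\,d\eta$,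 $\eta=\sum_ja_je_jW_j$ with $W_j$ independent standard Brownian motions. $\mu_\alpha$ is a stationary measure of it (a Borel probability measure on $L^2$ preserved by the Markov evolution), obtained as a weak limit along some $t_n\to\infty$ of the time averages $\frac1{t_n}\int_0^{t_n}\mathbb P(\theta(s)\in\cdot)\,ds$ for the solution with $\theta(0)=0$; these satisfy $\sup_{\alpha\in(0,1)}\int\|\theta\|^{2(q-1)}(\|\theta\|_{H^2}^2+\|\theta\|_{W^{1,4}}^4)\mu_\alpha(d\theta)<\infty$ for every $q\ge1$. The measure $\mu$ is the limit of $\mu_{\alpha_k}$ for a sequence $\alpha_k\to0$ (weak convergence of measures on $H^{2-\gamma}$, $\gamma>0$). It satisfies $\mu(H^2)=1$, $\mu$-almost every $\theta_0$ is the initial datum of a unique global solution of the SQG equation, $\mu$ is invariant under the resulting flow, and $\int_{L^2}\big(\|\theta\|_{H^{3/2}}^2+\int_{\mathbb T^2}|\nabla\theta|^2\nabla\theta\cdot\nabla(-\Delta)^{-1/2}\theta\,dx\big)\mu(d\theta)=\frac{A_{-1/2}}2$. *)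

(* Defs.v *)
From HB Require Import structures.
From mathcomp Require Import all_boot all_order all_algebra.
From mathcomp Require Import all_classical all_reals all_analysis.
From mathcomp Require Import measurable_realfun lebesgue_measure lebesgue_integral.
From mathcomp Require Import hoelder probability.

Set Implicit Arguments.
Unset Strict Implicit.
Unset Printing Implicit Defensive.

Import Order.TTheory GRing.Theory Num.Theory.
Import numFieldNormedType.Exports.

Local Open Scope classical_set_scope.
Local Open Scope ring_scope.
Local Open Scope quotient_scope.

Notation plane R := (measurableTypeR R * measurableTypeR R)%type.

(* The flat torus is R^2 / (2 pi Z)^2, represented by the fundamental cell
   [0, 2 pi[^2 with (unnormalized) Lebesgue measure.  A function on the torus is
   a function on the plane of which only the values on the cell matter, and
   these only almost everywhere. *)
Definition cell (R : realType) : set (plane R) :=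
  `[0, 2 * pi[%classic `*` `[0, 2 * pi[%classic.

Lemma measurable_cell (R : realType) : measurable (@cell R).
Proof. by apply: measurableX; exact: measurable_itv. Qed.

Definition torus (R : realType) : {measure set (plane R) -> \bar R} :=
  mrestr (@lebesgue_measure R \x @lebesgue_measure R)%E (@measurable_cell R).

Definition normL (R : realType) (p : R) (f : plane R -> R) : \bar R :=
  'N[torus R]_(p%:E)[EFin \o f]%E.

Definition fsub (R : realType) (f g : plane R -> R) : plane R -> R :=
  fun x => f x - g x.

Definition in_L2 (R : realType) (f : plane R -> R) : Prop :=
  f \in Lfun (torus R) 2%:E.

Definition dot (R : realType) (f g : plane R -> R) : R :=
  \int[torus R]_x (f x * g x).

Record L2 (R : realType) := MkL2 {
  L2_class : LspaceType2 (torus R);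
  L2_mean : \int[torus R]_x (L2_class x) = 0
}.

Definition L2_fun (R : realType) (f : L2 R) : plane R -> R :=
  fun x => L2_class f x.
Coercion L2_fun : L2 >-> Funclass.

Section zero.
Variable R : realType.

Let Z0 : {mfun plane R >-> measurableTypeR R} := cst 0.

Definition zero_mfun : {mfun_ torus R, plane R >-> measurableTypeR R} :=
  \pi_{mfun_ torus R, plane R >-> measurableTypeR R}%qT Z0.

Let zf : plane R -> R := zero_mfun.

Let zf_ae : \forall x \ae torus R, zf x = 0.
Proof.
have : (\pi_{mfun_ torus R, plane R >-> measurableTypeR R} (repr zero_mfun)
  = \pi_{mfun_ torus R, plane R >-> measurableTypeR R} Z0)%qT by rewrite reprK.
by move/eqmodP/asboolP; apply: filterS => x /= h; exact: h.
Qed.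

Let measurable_zf : measurable_fun setT (EFin \o zf).
Proof. by apply/measurable_EFinP; exact: (@measurable_funPT _ _ _ _ (repr zero_mfun)). Qed.

Let zero_mfun_norm : finite_norm (torus R) 2%:E zero_mfun.
Proof.
change (finite_norm (torus R) 2%:E zf); rewrite /finite_norm unlock /Lnorm.
rewrite (@ae_eq_integral _ _ _ (torus R) setT (cst 0%E))//.
- by rewrite integral0 poweR0r ?invr_eq0.
- apply: (measurableT_comp (measurable_poweR _)).
  exact: measurableT_comp measurable_zf.
- apply: filterS zf_ae => x /= h _.
  by rewrite h normr0 powR0// pnatr_eq0.
Qed.

HB.instance Definition _ := isFinLebesgue.Build _ _ R (torus R) 2%:R%:E
  (lee1n 2) zero_mfun zero_mfun_norm.

Let zero_mfun_mean :
  \int[torus R]_x ((zero_mfun : LspaceType2 (torus R)) x) = 0.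
Proof.
change (\int[torus R]_x zf x = 0); rewrite /Rintegral.
rewrite (@ae_eq_integral _ _ _ (torus R) setT (cst 0%E))//.
- by rewrite integral0.
- by apply: filterS zf_ae => x /= h _; rewrite h.
Qed.

Definition zeroL2 : L2 R := MkL2 zero_mfun_mean.

End zero.

Section borel.
Variable R : realType.

HB.instance Definition _ := gen_eqMixin (L2 R).
HB.instance Definition _ := gen_choiceMixin (L2 R).
HB.instance Definition _ := isPointed.Build (L2 R) (zeroL2 R).

End borel.

Definition openL2 (R : realType) : set (set (L2 R)) :=
  [set U | forall f : L2 R, U f -> exists2 r : R, 0 < r &
    forall g : L2 R, (normL 2 (fsub g f) < r%:E)%E -> U g].

Notation borelL2 R := (g_sigma_algebraType (@openL2 R)).

Definition phase (R : realType) (k : int * int) (x : plane R) : R :=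
  k.1%:~R * x.1 + k.2%:~R * x.2.

(* cos_coef f k - i sin_coef f k is the Fourier coefficient of f at k, so that
   f(x) = \sum_(k in Z^2) cos_coef f k cos(k.x) + sin_coef f k sin(k.x). *)
Definition cos_coef (R : realType) (f : plane R -> R) (k : int * int) : R :=
  dot f (fun x => cos (phase k x)) / (2 * pi) ^+ 2.

Definition sin_coef (R : realType) (f : plane R -> R) (k : int * int) : R :=
  dot f (fun x => sin (phase k x)) / (2 * pi) ^+ 2.

(* Square partial sums of the Fourier series of the image of f under the Fourier
   multiplier with symbol a(k) + i b(k), for a even and b odd in k. *)
Definition multiplier_sum (R : realType) (a b : int * int -> R)
    (f : plane R -> R) (N : nat) (x : plane R) : R :=
  \sum_(i < N.*2.+1) \sum_(j < N.*2.+1)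
    let k := (i%:Z - N%:Z, j%:Z - N%:Z) in
    (a k * cos_coef f k + b k * sin_coef f k) * cos (phase k x) +
    (a k * sin_coef f k - b k * cos_coef f k) * sin (phase k x).

Definition is_multiplier (R : realType) (a b : int * int -> R)
    (f g : plane R -> R) : Prop :=
  in_L2 g /\
  (fun N => normL 2 (fsub g (multiplier_sum a b f N))) @ \oo --> 0%E.

(* A function in the domain of the multiplier is sent to its image, which is
   unique up to equality almost everywhere; other functions are sent to 0. *)
Definition multiplier (R : realType) (a b : int * int -> R) (f : plane R -> R) :
  plane R -> R := xget (cst 0) [set g | is_multiplier a b f g].

(* |k|^(2s), the symbol of (-Delta)^s; its value at k = 0 (which is 1 for s = 0
   and 0 otherwise) is irrelevant for zero-mean functions. *)
Definition lap_symbol (R : realType) (s : R) (k : int * int) : R :=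
  ((k.1%:~R : R) ^+ 2 + k.2%:~R ^+ 2) `^ s.

Definition is_frac_lap (R : realType) (s : R) :=
  is_multiplier (lap_symbol s) (cst 0).
Definition frac_lap (R : realType) (s : R) :=
  multiplier (lap_symbol s) (cst 0).

Definition is_dx (R : realType) := @is_multiplier R (cst 0) (fun k => k.1%:~R).
Definition is_dy (R : realType) := @is_multiplier R (cst 0) (fun k => k.2%:~R).
Definition dx (R : realType) := @multiplier R (cst 0) (fun k => k.1%:~R).
Definition dy (R : realType) := @multiplier R (cst 0) (fun k => k.2%:~R).

Definition grad_dot (R : realType) (f g : plane R -> R) (x : plane R) : R :=
  dx f x * dx g x + dy f x * dy g x.

Definition normH (R : realType) (s : R) (f : plane R -> R) : \bar R :=
  if `[< exists g, is_frac_lap (s / 2) f g >] then normL 2 (frac_lap (s / 2) f)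
  else +oo%E.

Definition normW14 (R : realType) (f : plane R -> R) : \bar R :=
  if `[< (exists g, is_dx f g) /\ (exists g, is_dy f g) >]
  then normL 4 (fun x => Num.sqrt (grad_dot f f x)) else +oo%E.

Definition spaceH (R : realType) (s : R) : set (L2 R) :=
  [set f | (normH s f < +oo)%E].

(* u . grad f for u = (- d_y, d_x) (-Delta)^(-1/2) f *)
Definition transport (R : realType) (f : plane R -> R) (x : plane R) : R :=
  let psi := frac_lap (- 2^-1) f in - dy psi x * dx f x + dx psi x * dy f x.

(* v is the Bochner integral of F over [0, t] in L^2 of the torus; since L^2 is
   separable, strong measurability may be replaced by weak measurability. *)
Definition is_bochner (R : realType) (t : R) (F : R -> plane R -> R)
    (v : plane R -> R) : Prop :=
  [/\ {ae @lebesgue_measure R, forall s, s \in `[0, t] -> in_L2 (F s)},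
      forall phi, in_L2 phi -> measurable_fun `[0, t] (fun s => dot (F s) phi),
      (\int[@lebesgue_measure R]_(s in `[0%R, t]) normL 2 (F s) < +oo)%E &
      forall phi, in_L2 phi ->
        dot v phi = \int[@lebesgue_measure R]_(s in `[0, t]) dot (F s) phi].

(* Solutions are functions of t >= 0; their values at t < 0 are irrelevant.  The
   equation at t = 0 says f 0 = f0. *)
Definition global_solution (R : realType) (f0 : L2 R) (f : R -> L2 R) : Prop :=
  [/\ forall t : R, 0 <= t -> spaceH 1 (f t),
      forall t : R, 0 <= t -> forall r : R, 0 < r -> exists2 h : R, 0 < h &
        forall s : R, 0 <= s -> `|s - t| < h ->
          (normH 1 (fsub (f s) (f t)) < r%:E)%E,
      forall T : R, (\int[@lebesgue_measure R]_(s in `[0%R, T])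
        normH 2 (f s) ^+ 2 < +oo)%E &
      forall t : R, 0 <= t ->
        is_bochner t (fun s => transport (f s)) (fsub f0 (f t))].

Definition unique_global_solution (R : realType) (f0 : L2 R) (f : R -> L2 R) :
    Prop :=
  global_solution f0 f /\
  forall g, global_solution f0 g -> forall t : R, 0 <= t -> g t = f t.

Definition sqg_invariant (R : realType)
    (mu : probability (borelL2 R) R) : Prop :=
  exists Phi : R -> borelL2 R -> borelL2 R,
    [/\ forall t : R, 0 <= t -> measurable_fun setT (Phi t),
        {ae mu, forall f0, unique_global_solution f0 (Phi ^~ f0)} &
        forall t : R, 0 <= t -> forall B, measurable B ->
          mu (Phi t @^-1` B) = mu B].

Definition eigenbasis (R : realType) (e : nat -> L2 R) (lambda : nat -> R) :
    Prop :=
  [/\ 0 < lambda 0 /\ {homo lambda : i j / (i <= j)%N >-> i <= j},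
      forall i j, dot (e i) (e j) = (i == j)%:R,
      forall f : L2 R,
        (fun n => normL 2 (fsub f (fun x => \sum_(j < n) dot f (e j) * e j x)))
          @ \oo --> 0%E &
      forall j, is_frac_lap 1 (e j) (fun x => lambda j * e j x)].

Definition noise_sum (R : realType) (lambda a : nat -> R) (s : R) : \bar R :=
  (\sum_(0 <= j <oo) (lambda j `^ s * a j ^+ 2)%:E)%E.

Definition mutually_independent (R : realType) (d : measure_display)
    (Omega : measurableType d) (P : probability Omega R) (I : eqType)
    (X : I -> Omega -> R) : Prop :=
  forall (D : seq I) (B : I -> set R), uniq D ->
    (forall i, measurable (B i)) ->
    P (\big[setI/setT]_(i <- D) (X i @^-1` B i)) =
    (\prod_(i <- D) P (X i @^-1` B i))%E.

(* a sequence of independent standard Brownian motions: the increments are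
   mutually independent both over disjoint time intervals and over j *)
Definition brownian_motions (R : realType) (d : measure_display)
    (Omega : measurableType d) (P : probability Omega R)
    (W : nat -> R -> Omega -> R) : Prop :=
  [/\ forall j (t : R), 0 <= t -> measurable_fun setT (W j t),
      {ae P, forall w, forall j, W j 0 w = 0 /\
         {within `[0, +oo[%classic, continuous (fun t => W j t w)}},
      forall j (s t : R), 0 <= s -> s < t -> forall B, measurable B ->
        P ((fun w => W j t w - W j s w) @^-1` B) =
        normal_prob 0 (Num.sqrt (t - s)) B &
      forall tau : nat -> R, 0 <= tau 0%N -> {homo tau : m n / (m <= n)%N >-> m <= n} ->
        mutually_independent P (fun (i : nat * nat) w =>
          W i.1 (tau i.2.+1) w - W i.1 (tau i.2) w)].

(* f w is the path of the solution starting from f0, f w t its value at time t.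
   The equation is tested against the basis, with < eta(t), e_i > = a_i W_i(t)
   and with the viscous terms integrated by parts. *)
Definition stochastic_solution (R : realType) (d : measure_display)
    (Omega : measurableType d) (P : probability Omega R)
    (W : nat -> R -> Omega -> R) (e : nat -> L2 R) (a : nat -> R) (alpha : R)
    (f0 : L2 R) (f : Omega -> R -> L2 R) : Prop :=
  (forall t : R, 0 <= t -> measurable_fun setT (fun w => f w t : borelL2 R)) /\
  {ae P, forall w, [/\
    forall t : R, 0 <= t -> forall r : R, 0 < r -> exists2 h : R, 0 < h &
      forall s : R, 0 <= s -> `|s - t| < h ->
        (normL 2 (fsub (f w s) (f w t)) < r%:E)%E,
    forall T : R, (\int[@lebesgue_measure R]_(s in `[0%R, T])
      (normH 2 (f w s) ^+ 2 + normW14 (f w s) ^+ 4) < +oo)%E &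
    forall i (t : R), 0 <= t ->
      dot (f w t) (e i) = dot f0 (e i)
        - \int[@lebesgue_measure R]_(s in `[0, t])
            (dot (transport (f w s)) (e i)
             + alpha * dot (frac_lap 1 (f w s)) (frac_lap 1 (e i))
             + alpha * \int[torus R]_x
                 (grad_dot (f w s) (f w s) x * grad_dot (f w s) (e i) x))
        + Num.sqrt alpha * (a i * W i t w)]}.

Definition stationary (R : realType) (d : measure_display)
    (Omega : measurableType d) (P : probability Omega R)
    (W : nat -> R -> Omega -> R) (e : nat -> L2 R) (a : nat -> R) (alpha : R)
    (nu : probability (borelL2 R) R) : Prop :=
  exists2 sol : L2 R -> Omega -> R -> L2 R,
    forall f0, stochastic_solution P W e a alpha f0 (sol f0) &
    forall t : R, 0 <= t -> forall B : set (borelL2 R), measurable B ->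
      nu B = (\int[nu]_f0 P [set w | B (sol f0 w t)])%E.

(* Weak convergence along t_n of the time averages of the laws of the solution
   starting from 0, tested against bounded continuous functions on L^2. *)
Definition time_average_limit (R : realType) (d : measure_display)
    (Omega : measurableType d) (P : probability Omega R)
    (W : nat -> R -> Omega -> R) (e : nat -> L2 R) (a : nat -> R) (alpha : R)
    (nu : probability (borelL2 R) R) : Prop :=
  exists (sol : Omega -> R -> L2 R) (T : nat -> R),
    [/\ stochastic_solution P W e a alpha (zeroL2 R) sol,
        forall n, 0 < T n, T @ \oo --> +oo &
        forall phi : L2 R -> R,
          (exists M : R, forall f : L2 R, `|phi f| <= M) ->
          (forall f : L2 R, forall r : R, 0 < r -> exists2 h : R, 0 < h &
             forall g : L2 R, (normL 2 (fsub g f) < h%:E)%E ->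
               `|phi g - phi f| < r) ->
          (fun n => (T n)^-1 * \int[@lebesgue_measure R]_(s in `[0, T n])
             \int[P]_w phi (sol w s)) @ \oo --> \int[nu]_f phi f].

Definition moment_bounds (R : realType)
    (nu : R -> probability (borelL2 R) R) : Prop :=
  forall q : R, 1 <= q -> exists C : R, forall alpha : R, 0 < alpha < 1 ->
    (\int[nu alpha]_f (normL 2 f `^ (2 * (q - 1))
       * (normH 2 f ^+ 2 + normW14 f ^+ 4)) <= C%:E)%E.

(* weak convergence of measures on H^s; measures on H^s are identified with
   measures on L^2 carried by H^s *)
Definition weak_cvg_H (R : realType) (s : R)
    (nu : nat -> probability (borelL2 R) R) (mu : probability (borelL2 R) R) :
    Prop :=
  forall phi : L2 R -> R,
    (exists M : R, forall f : L2 R, spaceH s f -> `|phi f| <= M) ->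
    (forall f : L2 R, spaceH s f -> forall r : R, 0 < r -> exists2 h : R, 0 < h &
       forall g : L2 R, spaceH s g -> (normH s (fsub g f) < h%:E)%E ->
         `|phi g - phi f| < r) ->
    (fun n => \int[nu n]_(f in spaceH s) phi f) @ \oo -->
      \int[mu]_(f in spaceH s) phi f.

Definition inviscid_limit (R : realType) (alpha : nat -> R)
    (nu : R -> probability (borelL2 R) R) (mu : probability (borelL2 R) R) :
    Prop :=
  [/\ forall k, 0 < alpha k < 1, alpha @ \oo --> 0 &
      forall gamma : R, 0 < gamma ->
        weak_cvg_H (2 - gamma) (fun k => nu (alpha k)) mu].

Definition balance (R : realType) (lambda a : nat -> R)
    (mu : probability (borelL2 R) R) : Prop :=
  (\int[mu]_f (normH (3 / 2) f ^+ 2 +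
     (\int[torus R]_x (grad_dot f f x
        * grad_dot f (frac_lap (- 2^-1) f) x)%R)%:E)
   = noise_sum lambda a (- 2^-1) * (2^-1)%:E)%E.

Definition S_set (R : realType) (K : R) : set (L2 R) :=
  [set f | [/\ (normW14 f < +oo)%E, (normH (3 / 2) f < +oo)%E &
     (K%:E <= normW14 f ^+ 4 + normH (3 / 2) f ^+ 2)%E]].

(* Main.v *)
(* If mu(S_K) = 0, then mu-almost every f lies in H^2 and outside S_K.  By the Sobolev
   embedding H^1 in L^4 such an f has finite norms, hence ||f||_{W^{1,4}}^4 + ||f||_{H^{3/2}}^2 < K,
   and, as the Riesz transforms grad (-Delta)^(-1/2) f are bounded in H^1, hence in L^4,
   by ||f||_{H^{3/2}}, Young's inequality bounds the density in the balance relation by a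
   constant depending only on K.  So A_{-1/2} is bounded in terms of K, which fails for the
   noise a = (c, 0, 0, ...) with c large.

   Fourier series give everything else: f is in the domain of a multiplier iff the
   energies of its partial sums are bounded (Parseval and completeness of L^2), which
   makes the norms measurable, and the embedding in L^4 follows from splitting the
   partial sums into the blocks 4^j < |k| <= 4^(j+1). *)

Require Import Defs.
From HB Require Import structures.
From mathcomp Require Import all_boot all_order all_algebra.
From mathcomp Require Import all_classical all_reals all_analysis.
From mathcomp Require Import measurable_realfun lebesgue_measure lebesgue_integral.
From mathcomp Require Import hoelder probability.
From mathcomp Require Import ring lra zify.

Set Implicit Arguments.
Unset Strict Implicit.
Unset Printing Implicit Defensive.

Import Order.TTheory GRing.Theory Num.Theory.
Import numFieldNormedType.Exports.

Local Open Scope classical_set_scope.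
Local Open Scope ring_scope.

(** * Integrals over the torus *)

Section torus_integrals.
Variable R : realType.
Local Notation V := ((2 * pi) ^+ 2 : R).
Local Notation mu := (@lebesgue_measure R).
Local Notation leb2 := (mu \x mu)%E.

(** Derivatives and fractional Laplacians are functions picked by [xget], determined only up to null
    sets, so their dependence on f is opaque until it is expressed through Fourier coefficients,
    each of which is L^2-continuous in f. Squared Sobolev norms then become suprema of finite
    weighted sums, and the fourth power of the W^{1,4} norm becomes an iterated limit. Measurability
    of S_K is used twice: to place S_K in a measurable null set for the contradiction, and to
    compare it with the null set of bad initial data when theta_0 is extracted. The density of the
    balance relation is never shown measurable; its integral is bounded through simple functions.

    In the L^4 embedding the frequencies grow by powers of 4 because the L^2 gain 16^-j of a block
    has to beat the factor of order 8^j that the fourth power inequality with weights of order 2^-j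
    costs.

    Uniformity in f is needed only in part: H^2 makes the norms finite with a constant depending on
    f, and the bound itself comes from K. *)

Lemma integral_affine_cos (a b : R) : a != 0 -> sin (a * (2 * pi) + b) = sin b ->
  (\int[mu]_(y in `[0%R, (2 * pi)%R[) (cos (a * y + b))%:E = 0)%E.
Proof.
move=> a0 per.
have co : continuous (fun y : R => cos (a * y + b)).
  move=> y; apply: continuous_comp; last exact: continuous_cos.
  by apply: cvgD; [apply: cvgM; [exact: cvg_cst|exact: cvg_id]|exact: cvg_cst].
have dF (y : R) : is_derive y (1 : R) (fun y : R => a^-1 * sin (a * y + b)) (cos (a * y + b)).
  have -> : cos (a * y + b) = a^-1 *: (cos (a * y + b) * a) :> R.
    by rewrite /GRing.scale /= mulrCA mulVf// mulr1.
  apply: is_deriveZ; apply: is_derive1_comp.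
  have h : is_derive y (1 : R) (fun x : R => a * x + b) (a *: (1 : R) + 0).
    apply: (is_deriveD (f := fun x : R => a *: id x) (g := cst b)).
  apply: (is_derive_eq h). rewrite /GRing.scale /=. exact: etrans (addr0 _) (mulr1 _).
rewrite integral_itv_bndo_bndc; last first.
  apply/measurable_EFinP; apply: measurable_funTS; exact: continuous_measurable_fun.
rewrite (@continuous_FTC2 R (fun y => cos (a * y + b)) (fun y => a^-1 * sin (a * y + b))).
- by rewrite mulr0 add0r per subee.
- by rewrite mulr_gt0 ?pi_gt0.
- exact: continuous_subspaceT.
- have ct : continuous (fun y : R => a^-1 * sin (a * y + b)).
    by move=> y; apply/differentiable_continuous/derivable1_diffP; apply: ex_derive.
  split; first by move=> y _; exact: ex_derive.
  + exact: cvg_at_right_filter (ct _).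
  + exact: cvg_at_left_filter (ct _).
- by move=> y _; rewrite derive1E; exact: derive_val.
Qed.

Lemma torus_setT : torus R setT = V%:E.
Proof.
rewrite /torus /= /mrestr setTI product_measure1E; [|exact: measurable_itv..].
rewrite /= lebesgue_measure_itv /= lte_fin mulr_gt0 ?pi_gt0// oppr0 adde0.
by rewrite -EFinM.
Qed.

(** The working class for trigonometric polynomials: stable under sums and products, and integrable
    because the torus has finite measure, so that integrability conditions reduce to closure
    rules. *)
Definition bmfun (h : plane R -> R) :=
  measurable_fun setT h /\ exists M, forall x, `|h x| <= M.

Lemma bmfun_cst r : bmfun (cst r).
Proof. by split; [exact: measurable_cst|exists `|r|]. Qed.

Lemma bmfunD g h : bmfun g -> bmfun h -> bmfun (fun x => g x + h x).
Proof.
move=> [mg [M gM]] [mh [N hN]]; split; first exact: measurable_funD.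
by exists (M + N) => x; rewrite (le_trans (ler_normD _ _))// lerD.
Qed.

Lemma bmfunM g h : bmfun g -> bmfun h -> bmfun (fun x => g x * h x).
Proof.
move=> [mg [M gM]] [mh [N hN]]; split; first exact: measurable_funM.
by exists (M * N) => x; rewrite normrM ler_pM.
Qed.

Lemma bmfun_sum (I : Type) (s : seq I) (h : I -> plane R -> R) :
  (forall i, bmfun (h i)) -> bmfun (fun x => \sum_(i <- s) h i x).
Proof.
move=> bh; elim: s => [|i s IH].
  by under eq_fun do rewrite big_nil; exact: bmfun_cst.
by under eq_fun do rewrite big_cons; exact: bmfunD.
Qed.

Lemma measurable_phase k : measurable_fun setT (@phase R k).
Proof.
by apply: measurable_funD; apply: measurable_funM.
Qed.

Lemma bmfun_cos k : bmfun (fun x => cos (phase k x)).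
Proof.
split; last by exists 1 => x; exact: cos_max.
apply: measurableT_comp (measurable_phase k).
by apply: continuous_measurable_fun; exact: continuous_cos.
Qed.

Lemma bmfun_sin k : bmfun (fun x => sin (phase k x)).
Proof.
split; last by exists 1 => x; exact: sin_max.
apply: measurableT_comp (measurable_phase k).
by apply: continuous_measurable_fun; exact: continuous_sin.
Qed.

Lemma torus_fin : (torus R setT < +oo)%E.
Proof. by rewrite torus_setT ltry. Qed.

Lemma bounded_bmfun h A : bmfun h -> [bounded h x | x in A].
Proof.
move=> [_ [M hM]]; exists M; split; first exact: num_real.
by move=> r Mr x _; exact: le_trans (hM x) (ltW Mr).
Qed.

Lemma bmfun_integrable h : bmfun h -> (torus R).-integrable setT (EFin \o h).
Proof.
move=> bh; apply: measurable_bounded_integrable => //.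
- exact: torus_fin.
- exact: bh.1.
- exact: bounded_bmfun.
Qed.

Lemma leb2_cell : leb2 (@cell R) = V%:E.
Proof. by rewrite -torus_setT /torus /= /mrestr setTI. Qed.

(** Fubini's theorem is stated for a product measure, whereas [torus] restricts one to the cell; the
    restriction is moved into the integrand. *)
Lemma integral_torus h : bmfun h ->
  (\int[torus R]_x (h x)%:E = \int[leb2]_x (((EFin \o h) \_ (@cell R)) x))%E.
Proof.
move=> bh; have mc := @measurable_cell R.
rewrite -integral_mkcond.
have -> : (\int[leb2]_(x in @cell R) (h x)%:E = \int[torus R]_(x in @cell R) (h x)%:E)%E.
  apply: eq_measure_integral => A mA Ac.
  by rewrite /torus /= /mrestr setIidl.
rewrite (@negligible_integral _ _ _ _ _ (~` @cell R))//.
- by rewrite setTD setCK.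
- exact: measurableC.
- exact: bmfun_integrable.
- by rewrite /torus /= /mrestr setICl measure0.
Qed.

Lemma leb2_integrable h : bmfun h ->
  leb2.-integrable setT ((EFin \o h) \_ (@cell R)).
Proof.
move=> bh; have mc := @measurable_cell R.
rewrite -integrable_mkcond//; apply: measurable_bounded_integrable => //.
- by have cV : (leb2 (@cell R) < +oo)%E; [rewrite leb2_cell ltry|exact: cV].
- exact: measurable_funTS bh.1.
- exact: bounded_bmfun.
Qed.

Lemma sin_shift (k : int) (b : R) : sin (k%:~R * (2 * pi) + b) = sin b.
Proof.
rewrite addrC mulr_natl.
case: k => n; first by rewrite [_%:~R]/= mulr_natl; exact: (periodicn (@sinD2pi R)).
rewrite NegzE rmorphN /= mulNr mulr_natl.
by rewrite -(periodicn (@sinD2pi R) n.+1 (b - _)) subrK.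
Qed.

(** Integration in a coordinate of nonzero frequency runs over full periods, the other coordinate
    acting as a phase. The free phase b lets the same lemma serve for sines. *)
Lemma integral_torus_cos (k : int * int) (b : R) : k != 0 ->
  (\int[torus R]_x (cos (phase k x + b))%:E = 0)%E.
Proof.
move=> k0.
have bh : bmfun (fun x => cos (phase k x + b)).
  split; last by exists 1 => x; exact: cos_max.
  have mc : measurable_fun setT (@cos R).
    by apply: continuous_measurable_fun; exact: continuous_cos.
  apply: (measurableT_comp mc); apply: measurable_funD => //.
  exact: measurable_phase.
rewrite integral_torus//.
have [k20|k20] := eqVneq k.2 0.
  have k10 : k.1 != 0 by apply: contra k0 => /eqP k10; case: k k10 k20 {bh} => /= i j -> ->.
  rewrite -integral21_prod_meas1; last exact: leb2_integrable.
  apply: integral0_eq => y _; rewrite /fubini_G.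
  have [yI|yI] := pselect (`[0, 2 * pi[%classic y); last first.
    apply: integral0_eq => x _; rewrite patchE memNset//; by case.
  rewrite -[RHS](@integral_affine_cos (k.1)%:~R (k.2%:~R * y + b)).
  - rewrite [RHS]integral_mkcond; apply: eq_integral => x _.
    rewrite !patchE; case: ifPn; case: ifPn => //=; rewrite /phase/= ?addrA//.
    + by rewrite inE notin_setE /cell => h [].
    + by rewrite inE notin_setE /cell => h [].
  - by rewrite intr_eq0.
  - exact: sin_shift.
rewrite -integral12_prod_meas1; last exact: leb2_integrable.
apply: integral0_eq => x _; rewrite /fubini_F.
have [xI|xI] := pselect (`[0, 2 * pi[%classic x); last first.
  apply: integral0_eq => y _; rewrite patchE memNset//; by case.
rewrite -[RHS](@integral_affine_cos (k.2)%:~R (k.1%:~R * x + b)).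
- rewrite [RHS]integral_mkcond; apply: eq_integral => y _.
  rewrite !patchE; case: ifPn; case: ifPn => //=; rewrite /phase/= ?addrA ?(addrC (_ * y))//.
  + by rewrite inE notin_setE /cell => h [].
  + by rewrite inE notin_setE /cell => h [].
- by rewrite intr_eq0.
- exact: sin_shift.
Qed.

Lemma Rintegral_cos k : \int[torus R]_x cos (phase k x) = (k == 0)%:R * V.
Proof.
have [->|k0] := eqVneq k 0.
  rewrite mul1r (@eq_Rintegral _ _ _ _ _ (cst 1)).
    by rewrite Rintegral_cst// torus_setT mul1r.
  by move=> x _; rewrite /phase /= !mul0r addr0 cos0.
rewrite mul0r /Rintegral -[RHS]/(fine 0%E).
rewrite -(integral_torus_cos 0 k0).
by congr fine; apply: eq_integral => x _; rewrite addr0.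
Qed.

Lemma Rintegral_sin k : \int[torus R]_x sin (phase k x) = 0.
Proof.
have [->|k0] := eqVneq k 0.
  rewrite (@eq_Rintegral _ _ _ _ _ (cst 0)).
    by rewrite Rintegral_cst// torus_setT mul0r.
  by move=> x _; rewrite /phase /= !mul0r addr0 sin0.
rewrite /Rintegral -[RHS]/(fine 0%E).
rewrite -(integral_torus_cos (- (pi / 2)) k0).
by congr fine; apply: eq_integral => x _; rewrite cosBpihalf.
Qed.

End torus_integrals.

(** * Trigonometric polynomials *)

Section trigonometric_polynomials.
Variable R : realType.
Local Notation V := ((2 * pi) ^+ 2 : R).
Implicit Types (c s : int * int -> R) (k l : int * int) (N : nat).

Lemma Rintegral_bmfunD (g h : plane R -> R) : bmfun g -> bmfun h ->
  \int[torus R]_x (g x + h x) = \int[torus R]_x g x + \int[torus R]_x h x.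
Proof. by move=> bg bh; rewrite RintegralD//; exact: bmfun_integrable. Qed.

Lemma Rintegral_bmfunZ a (h : plane R -> R) : bmfun h ->
  \int[torus R]_x (a * h x) = a * \int[torus R]_x h x.
Proof. by move=> bh; rewrite RintegralZl//; exact: bmfun_integrable. Qed.

Lemma Rintegral_bmfun_sum (I : Type) (r : seq I) (h : I -> plane R -> R) :
  (forall i, bmfun (h i)) ->
  \int[torus R]_x (\sum_(i <- r) h i x) = \sum_(i <- r) \int[torus R]_x h i x.
Proof.
move=> bh; elim: r => [|i r IH].
  rewrite big_nil (@eq_Rintegral _ _ _ _ _ (cst 0)).
    by rewrite Rintegral_cst// mul0r.
  by move=> x _; rewrite big_nil.
rewrite big_cons -IH -Rintegral_bmfunD//; last exact: bmfun_sum.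
by apply: eq_Rintegral => x _; rewrite big_cons.
Qed.

Lemma phaseD k l (x : plane R) : phase (k + l) x = phase k x + phase l x.
Proof. by rewrite /phase /= !intrD; ring. Qed.

Lemma phaseN k (x : plane R) : phase (- k) x = - phase k x.
Proof. by rewrite /phase /= !intrN; ring. Qed.

Lemma Rintegral_coscos k l :
  \int[torus R]_x (cos (phase k x) * cos (phase l x)) =
  V / 2 * ((k == l)%:R + (k == - l)%:R).
Proof.
have -> : (fun x : plane R => cos (phase k x) * cos (phase l x)) =
  (fun x => 2^-1 * (cos (phase (k - l) x) + cos (phase (k + l) x))).
  by apply/funext => x; rewrite !phaseD phaseN cosD cosD cosN sinN; field.
rewrite Rintegral_bmfunZ; last by apply: bmfunD; exact: bmfun_cos.
rewrite Rintegral_bmfunD; [|exact: bmfun_cos..].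
by rewrite !Rintegral_cos subr_eq0 addr_eq0; field.
Qed.

Lemma Rintegral_sinsin k l :
  \int[torus R]_x (sin (phase k x) * sin (phase l x)) =
  V / 2 * ((k == l)%:R - (k == - l)%:R).
Proof.
have -> : (fun x : plane R => sin (phase k x) * sin (phase l x)) =
  (fun x => 2^-1 * (cos (phase (k - l) x) + -1 * cos (phase (k + l) x))).
  by apply/funext => x; rewrite !phaseD phaseN cosD cosD cosN sinN; field.
have bc := @bmfun_cos R (k + l).
have bd := bmfunM (@bmfun_cst R (-1)) bc.
rewrite Rintegral_bmfunZ; last by apply: bmfunD => //; exact: bmfun_cos.
rewrite Rintegral_bmfunD//; last exact: bmfun_cos.
rewrite (@Rintegral_bmfunZ (-1))//.
by rewrite !Rintegral_cos subr_eq0 addr_eq0; field.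
Qed.

Lemma Rintegral_sincos k l :
  \int[torus R]_x (sin (phase k x) * cos (phase l x)) = 0.
Proof.
have -> : (fun x : plane R => sin (phase k x) * cos (phase l x)) =
  (fun x => 2^-1 * (sin (phase (k - l) x) + sin (phase (k + l) x))).
  by apply/funext => x; rewrite !phaseD phaseN sinD sinD cosN sinN; field.
rewrite Rintegral_bmfunZ; last by apply: bmfunD; exact: bmfun_sin.
rewrite Rintegral_bmfunD; [|exact: bmfun_sin..].
by rewrite !Rintegral_sin addr0 mulr0.
Qed.

(** Square truncation of the frequencies, enumerated in the order of the double sum in
    [multiplier_sum]. *)
Definition box N : seq (int * int) :=
  [seq (i%:Z - N%:Z, j%:Z - N%:Z) | i <- iota 0 N.*2.+1, j <- iota 0 N.*2.+1].

Lemma mem_box N k : (k \in box N) = (`|k.1|%N <= N)%N && (`|k.2|%N <= N)%N.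
Proof.
apply/allpairsP/idP => [[[i j] [iN jN ->]]|/andP[k1 k2]].
  by move: iN jN; rewrite !mem_iota /=; lia.
exists (`|(k.1 + N%:Z)%R|%N, `|(k.2 + N%:Z)%R|%N); split.
- by rewrite mem_iota /=; lia.
- by rewrite mem_iota /=; lia.
- by case: k k1 k2 => a b /= k1 k2; congr pair; lia.
Qed.

Lemma box_uniq N : uniq (box N).
Proof.
apply: allpairs_uniq; [exact: iota_uniq|exact: iota_uniq|].
by move=> [i j] [i' j'] _ _ /= [ii jj]; congr pair; lia.
Qed.

Lemma size_box N : size (box N) = (N.*2.+1 * N.*2.+1)%N.
Proof. by rewrite size_allpairs !size_iota. Qed.

Lemma sub_box M N : (M <= N)%N -> {subset box M <= box N}.
Proof. by move=> MN k; rewrite !mem_box => /andP[h1 h2]; rewrite !(leq_trans _ MN). Qed.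

Lemma mem_boxN N k : (- k \in box N) = (k \in box N).
Proof. by rewrite !mem_box /=; lia. Qed.

Lemma big_box_sub (F : int * int -> R) M N : (M <= N)%N ->
  \sum_(k <- box M) F k = \sum_(k <- box N | k \in box M) F k.
Proof.
move=> MN; rewrite -[RHS]big_filter; apply: perm_big; apply: uniq_perm.
- exact: box_uniq.
- exact/filter_uniq/box_uniq.
- move=> k; rewrite mem_filter; case: (boolP (k \in box M)) => //= kM.
  by rewrite (sub_box MN).
Qed.

Definition trig c s N (x : plane R) : R :=
  \sum_(k <- box N) (c k * cos (phase k x) + s k * sin (phase k x)).

(** With a Fourier coefficient written as c - i s, multiplication by a + i b gives (a c + b s) - i
    (a s - b c). *)
Definition mult_cos (a b : int * int -> R) (f : plane R -> R) k : R :=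
  a k * cos_coef f k + b k * sin_coef f k.

Definition mult_sin (a b : int * int -> R) (f : plane R -> R) k : R :=
  a k * sin_coef f k - b k * cos_coef f k.

Lemma multiplier_sumE a b (f : plane R -> R) N :
  multiplier_sum a b f N = trig (mult_cos a b f) (mult_sin a b f) N.
Proof.
apply/funext => x; rewrite /multiplier_sum /trig /box big_allpairs_dep.
rewrite -[in RHS](subn0 N.*2.+1) -/(index_iota _ _) big_mkord.
apply: eq_bigr => i _.
by rewrite -/(index_iota _ _) big_mkord.
Qed.

Lemma bmfun_term c s k :
  bmfun (fun x : plane R => c k * cos (phase k x) + s k * sin (phase k x)).
Proof.
apply: bmfunD.
- by apply: (bmfunM (bmfun_cst (c k))); exact: bmfun_cos.
- by apply: (bmfunM (bmfun_cst (s k))); exact: bmfun_sin.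
Qed.

Lemma bmfun_trig c s N : bmfun (trig c s N).
Proof. by apply: bmfun_sum => k; exact: bmfun_term. Qed.

Lemma sum_delta (r : seq (int * int)) (F : int * int -> R) l : uniq r ->
  \sum_(k <- r) F k * (k == l)%:R = (l \in r)%:R * F l.
Proof.
move=> ur; have [lr|lr] := boolP (l \in r).
  rewrite (bigD1_seq l)//= eqxx mulr1 mul1r big1 ?addr0// => k /negbTE ->.
  by rewrite mulr0.
rewrite mul0r big1_seq// => k /= kr.
by case: eqVneq => [kl|]; [rewrite -kl kr in lr|rewrite mulr0].
Qed.

Lemma Rintegral_trigM c s N (h : plane R -> R) : bmfun h ->
  \int[torus R]_x (trig c s N x * h x) =
  \sum_(k <- box N) (c k * \int[torus R]_x (cos (phase k x) * h x) +
                     s k * \int[torus R]_x (sin (phase k x) * h x)).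
Proof.
move=> bh.
have -> : (fun x => trig c s N x * h x) = fun x =>
    \sum_(k <- box N) (c k * (cos (phase k x) * h x) + s k * (sin (phase k x) * h x)).
  apply/funext => x; rewrite /trig mulr_suml; apply: eq_bigr => k _; ring.
have bc k : bmfun (fun x => cos (phase k x) * h x) by apply: bmfunM => //; exact: bmfun_cos.
have bs k : bmfun (fun x => sin (phase k x) * h x) by apply: bmfunM => //; exact: bmfun_sin.
have bZ (r : R) g : bmfun g -> bmfun (fun x => r * g x) by exact/bmfunM/bmfun_cst.
rewrite Rintegral_bmfun_sum; last by move=> k; apply: bmfunD; exact: bZ.
apply: eq_bigr => k _.
by rewrite Rintegral_bmfunD ?Rintegral_bmfunZ//; exact: bZ.
Qed.

(* Hermitian symmetry of the complex coefficients c k - i s k. *)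
Definition hermitian_coef c s := forall k, c (- k) = c k /\ s (- k) = - s k.

(** The frequencies l and -l each contribute V / 2, and Hermitian symmetry makes the two
    contributions equal. *)
Lemma Rintegral_trig_cos c s N l : hermitian_coef c s ->
  \int[torus R]_x (trig c s N x * cos (phase l x)) = (l \in box N)%:R * (V * c l).
Proof.
move=> cs; rewrite Rintegral_trigM; last exact: bmfun_cos.
under eq_bigr => k _ do rewrite Rintegral_sincos mulr0 addr0 Rintegral_coscos.
transitivity (\sum_(k <- box N) (V / 2) * (c k * (k == l)%:R + c k * (k == - l)%:R)).
  by apply: eq_bigr => k _; ring.
rewrite -mulr_sumr big_split /= !sum_delta ?box_uniq// mem_boxN (cs l).1.
by field.
Qed.

Lemma Rintegral_trig_sin c s N l : hermitian_coef c s ->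
  \int[torus R]_x (trig c s N x * sin (phase l x)) = (l \in box N)%:R * (V * s l).
Proof.
move=> cs; rewrite Rintegral_trigM; last exact: bmfun_sin.
have E k : \int[torus R]_x (cos (phase k x) * sin (phase l x)) = 0.
  by rewrite -[RHS](Rintegral_sincos l k); apply: eq_Rintegral => x _; rewrite mulrC.
under eq_bigr => k _ do rewrite E mulr0 add0r Rintegral_sinsin.
transitivity (\sum_(k <- box N) (V / 2) * (s k * (k == l)%:R + - (s k * (k == - l)%:R))).
  by apply: eq_bigr => k _; ring.
rewrite -mulr_sumr big_split /= sumrN !sum_delta ?box_uniq// mem_boxN (cs l).2.
by field.
Qed.

(** Only one factor is expanded; its terms are then paired with the whole polynomial, which returns
    single coefficients. *)
Lemma Parseval c s N : hermitian_coef c s ->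
  \int[torus R]_x (trig c s N x ^+ 2) = V * \sum_(k <- box N) (c k ^+ 2 + s k ^+ 2).
Proof.
move=> cs.
rewrite (@eq_Rintegral _ _ _ _ _ (fun x => trig c s N x * trig c s N x)); last first.
  by move=> x _; rewrite expr2.
rewrite Rintegral_trigM; last exact: bmfun_trig.
rewrite mulr_sumr big_seq [RHS]big_seq; apply: eq_bigr => k kN.
have -> : \int[torus R]_x (cos (phase k x) * trig c s N x) = V * c k.
  rewrite -[RHS]mul1r -[X in X * _](_ : (k \in box N)%:R = 1); last by rewrite kN.
  by rewrite -(Rintegral_trig_cos N k cs); apply: eq_Rintegral => x _; rewrite mulrC.
have -> : \int[torus R]_x (sin (phase k x) * trig c s N x) = V * s k.
  rewrite -[RHS]mul1r -[X in X * _](_ : (k \in box N)%:R = 1); last by rewrite kN.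
  by rewrite -(Rintegral_trig_sin N k cs); apply: eq_Rintegral => x _; rewrite mulrC.
by ring.
Qed.

(** A difference of partial sums is again a trigonometric polynomial, with masked coefficients, so
    Parseval and the sup bound apply to frequency blocks. *)
Lemma trigB c s M N (x : plane R) : (M <= N)%N ->
  trig c s N x - trig c s M x =
  trig (fun k => (k \notin box M)%:R * c k) (fun k => (k \notin box M)%:R * s k) N x.
Proof.
move=> MN; rewrite /trig.
pose F k := c k * cos (phase k x) + s k * sin (phase k x).
rewrite (big_box_sub F MN) -/F (bigID (fun k => k \in box M))/= addrC addrK big_mkcond/=.
apply: eq_bigr => k _; rewrite -/(F k) /F.
by case: (k \in box M) => /=; rewrite ?mul0r ?mul1r ?addr0.
Qed.

Lemma hermitian_mask c s M : hermitian_coef c s ->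
  hermitian_coef (fun k => (k \notin box M)%:R * c k) (fun k => (k \notin box M)%:R * s k).
Proof. by move=> cs k; rewrite mem_boxN (cs k).1 (cs k).2 mulrN. Qed.

(** Valid for every g, since the positive and negative parts merely swap and [fine] sends infinite
    values to 0. This yields the parity of the Fourier coefficients of arbitrary functions. *)
Lemma RintegralN d (T : measurableType d) (mu : {measure set T -> \bar R}) (g : T -> R) :
  \int[mu]_x (- g x) = - \int[mu]_x g x.
Proof.
rewrite /Rintegral integralE [in RHS]integralE.
have -> : (fun x => (- g x)%:E) = (\- (EFin \o g))%E by apply/funext.
rewrite funeposN funenegN; set a := integral _ _ _; set b := integral _ _ _.
have : (0 <= a)%E by exact: integral_ge0.
have : (0 <= b)%E by exact: integral_ge0.
by case: a => [a| |]; case: b => [b| |] //= _ _; rewrite ?oppr0// opprB.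
Qed.

Lemma hermitian_mult a b (f : plane R -> R) :
  (forall k, a (- k) = a k) -> (forall k, b (- k) = - b k) ->
  hermitian_coef (mult_cos a b f) (mult_sin a b f).
Proof.
move=> ae bo k.
have ce : cos_coef f (- k) = cos_coef f k.
  congr (_ / _); apply: eq_Rintegral => x _; by rewrite phaseN cosN.
have se : sin_coef f (- k) = - sin_coef f k.
  rewrite /sin_coef -mulNr; congr (_ / _).
  have -> : (fun x : plane R => sin (phase (- k) x)) = fun x => - sin (phase k x).
    by apply/funext => x; rewrite phaseN sinN.
  rewrite /dot -RintegralN; apply: eq_Rintegral => x _; exact: mulrN.
by split; rewrite /mult_cos /mult_sin ce se ae bo; ring.
Qed.

End trigonometric_polynomials.

(** * Completeness of L^2 *)

Section L2_completeness.
Context d (T : measurableType d) (R : realType) (mu : {measure set T -> \bar R}).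

Definition sqint (h : T -> R) : \bar R := (\int[mu]_x ((h x) ^+ 2)%:E)%E.

Lemma sqint_ge0 h : (0 <= sqint h)%E.
Proof. by apply: integral_ge0 => x _; rewrite lee_fin sqr_ge0. Qed.

Lemma measurable_sqr (h : T -> R) : measurable_fun setT h ->
  measurable_fun setT (fun x => ((h x) ^+ 2)%:E).
Proof. by move=> mh; apply/measurable_EFinP; exact: measurable_funX. Qed.

(** Pointwise |h| <= h^2 / r + r. The free r replaces the Cauchy-Schwarz inequality when L^2
    smallness is turned into L^1 smallness. *)
Lemma integral_norm_le_sqint (h : T -> R) (r : R) : measurable_fun setT h -> 0 < r ->
  (\int[mu]_x (`|h x|)%:E <= r^-1%:E * sqint h + r%:E * mu setT)%E.
Proof.
move=> mh r0; rewrite -integral_cst// /sqint -ge0_integralZl_EFin//;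
  try by [move=> x _; rewrite lee_fin sqr_ge0|exact: measurable_sqr|rewrite invr_ge0 ltW].
rewrite -ge0_integralD//; first last.
- by move=> x _; rewrite lee_fin ltW.
- by apply: measurable_funeM; exact: measurable_sqr.
- by move=> x _; rewrite -EFinM lee_fin mulr_ge0 ?sqr_ge0// invr_ge0 ltW.
apply: ge0_le_integral => //.
- by apply/measurable_EFinP; exact: measurableT_comp.
- apply: emeasurable_funD => //.
  by apply: measurable_funeM; exact: measurable_sqr.
- move=> x _; rewrite -EFinM -EFinD lee_fin.
  rewrite -(ler_pM2l r0) mulrDr.
  rewrite mulrA mulfV ?gt_eqF// mul1r -(real_normK (num_real (h x))).
  have := sqr_ge0 (`|h x| - r); have := sqr_ge0 (`|h x|); have := sqr_ge0 r; nra.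
Qed.

Hypothesis mu_fin : (mu setT < +oo)%E.

(** Riesz-Fischer: a subsequence with squared increments at most 4^-(k+1) has summable L^1
    increments, hence converges almost everywhere, and Fatou's lemma turns this into L^2 convergence
    of the whole sequence. *)
Lemma L2_complete (u : nat -> T -> R) : (forall n, measurable_fun setT (u n)) ->
  (forall e : R, 0 < e -> exists N, forall m n, (N <= m)%N -> (N <= n)%N ->
     (sqint (fun x => (u m x - u n x)%R) <= e%:E)%E) ->
  exists g : T -> R, measurable_fun setT g /\
    forall e : R, 0 < e -> exists N, forall n, (N <= n)%N ->
      (sqint (fun x => (g x - u n x)%R) <= e%:E)%E.
Proof.
move=> mu_ cu.
have cu4 k : exists N, forall m n, (N <= m)%N -> (N <= n)%N ->
    (sqint (fun x => (u m x - u n x)%R) <= ((4 ^ k.+1)%:R^-1)%:E)%E.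
  by apply: cu; rewrite invr_gt0 ltr0n expn_gt0.
have [N NP] := choice cu4.
(* The partial sums of [N] put both [n_ k] and [n_ k.+1] beyond [N k], and the added k makes [n_]
   unbounded. *)
pose n_ k := (\sum_(i < k.+1) N i + k)%N.
have nN k : (N k <= n_ k)%N by rewrite /n_ big_ord_recr/=; lia.
have nN' k : (N k <= n_ k.+1)%N by rewrite /n_ 2!big_ord_recr/=; lia.
have nk k : (k <= n_ k)%N by rewrite /n_ leq_addl.
pose v k x := u (n_ k.+1) x - u (n_ k) x.
have mv k : measurable_fun setT (v k) by exact: measurable_funB.
pose M := fine (mu setT).
have muM : mu setT = M%:E by rewrite fineK// ge0_fin_numE.
have M0 : 0 <= M by apply: fine_ge0.
(* With r = 2^-(k+1), both r^-1 4^-(k+1) and r M are of order 2^-(k+1). *)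
have vint k : (\int[mu]_x (`|v k x|)%:E <= ((1 + M) / (2 ^ k.+1)%:R)%:E)%E.
  have p2 : 0 < (2 ^ k.+1)%:R :> R by rewrite ltr0n expn_gt0.
  apply: le_trans (integral_norm_le_sqint (mv k) (_ : 0 < (2 ^ k.+1)%:R^-1)) _.
    by rewrite invr_gt0.
  rewrite muM -EFinM mulrDl EFinD invrK; apply: leeD; last by rewrite lee_fin mulrC.
  apply: le_trans (lee_pmul _ _ (lexx _) (NP k _ _ (nN' k) (nN k))) _.
  - by rewrite lee_fin ltW.
  - exact: sqint_ge0.
  rewrite -EFinM lee_fin mul1r (_ : 4 = 2 * 2)%N// expnMn natrM invfM mulrA.
  by rewrite mulfV ?mul1r// gt_eqF.
pose S x := (\sum_(k <oo) (`|v k x|)%:E)%E.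
have mvE k : measurable_fun setT (fun x => (`|v k x|)%:E).
  by apply/measurable_EFinP; exact: measurableT_comp.
have Sint : (\int[mu]_x S x <= (1 + M)%:E)%E.
  rewrite integral_nneseries//.
  apply: le_trans (epsilon_trick0 xpredT _); last by rewrite addr_ge0.
  by apply: lee_nneseries => k *; [apply: integral_ge0 => x _; rewrite lee_fin|exact: vint].
have S0 x : (0 <= S x)%E by apply: nneseries_ge0.
have mS : measurable_fun setT S by apply: ge0_emeasurable_sum.
have iS : mu.-integrable setT S.
  apply/integrableP; split => //.
  under eq_integral do rewrite gee0_abs//.
  by rewrite (le_lt_trans Sint) ?ltry.
have aeS : {ae mu, forall x, cvgn (fun k => u (n_ k) x)}.
  apply: filterS (integrable_ae measurableT iS) => x /(_ I) Sx.
  have cv : cvgn (series (fun k => v k x)).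
    apply: normed_cvg; apply: nondecreasing_is_cvgn.
      by apply/nondecreasing_seqP => k; rewrite /= !seriesEnat /= big_nat_recr//= lerDl.
    exists (fine (S x)) => _ [k _ <-].
    rewrite -lee_fin fineK// /series/= -sumEFin.
    exact: nneseries_lim_ge.
  have uE : (fun k => u (n_ k) x) = (fun k => series (fun k => v k x) k + u (n_ 0%N) x).
    apply/funext; elim=> [|k IH]; first by rewrite /series/= big_geq// add0r.
    by rewrite seriesSr -addrAC /= -IH /v; ring.
  by rewrite uE; apply: is_cvgD => //; exact: is_cvg_cst.
(* The upper limit is measurable everywhere and agrees with the limit wherever the subsequence
   converges. *)
pose g x := fine (limn_esup (fun k => (u (n_ k) x)%:E)).
have mg : measurable_fun setT g.
  apply: (measurableT_comp (fine_measurable measurableT)).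
  apply: measurable_fun_limn_esup => k; exact/measurable_EFinP.
exists g; split => // e e0.
have [K KP] := cu e e0; exists K => n Kn.
pose F k x := ((u (n_ k) x - u n x) ^+ 2)%:E.
have mF k : measurable_fun setT (F k) by apply: measurable_sqr; exact: measurable_funB.
have F0 k x : (0 <= F k x)%E by rewrite lee_fin sqr_ge0.
have -> : sqint (fun x => g x - u n x) = (\int[mu]_x limn_einf (F ^~ x))%E.
  apply: ae_eq_integral => //.
  - by apply: measurable_sqr; exact: measurable_funB.
  - have -> : (fun x => limn_einf (F^~ x)) = fun x => (- limn_esup (fun k => - F k x))%E.
      by apply/funext => x; rewrite -limn_einfN; congr limn_einf;
        apply/funext => k; rewrite /comp oppeK.
    apply: measurableT_comp => //; apply: measurable_fun_limn_esup => k.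
    exact: measurableT_comp.
  - apply: filterS aeS => x cx _.
    have cE : (u (n_ k) x)%:E @[k --> \oo] --> (limn (fun k => u (n_ k) x))%:E.
      by apply: cvg_EFin; [exact: nearW|exact: cx].
    have -> : g x = limn (fun k => u (n_ k) x) by rewrite /g (cvg_limn_einf_sup cE).2.
    suff cF : F k x @[k --> \oo] --> ((limn (fun k => u (n_ k) x) - u n x) ^+ 2)%:E.
      by rewrite (cvg_limn_einf_sup cF).1.
    apply: cvg_EFin; first exact: nearW.
    by rewrite expr2; apply: cvgM; apply: cvgB => //; exact: cvg_cst.
apply: le_trans (fatou _ measurableT mF _) _ => //.
rewrite limn_einf_lim; apply: lime_le; first exact: is_cvg_einfs.
apply: nearW => k; apply: (@le_trans _ _ (\int[mu]_x F (maxn k K) x)%E).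
  by apply: ereal_inf_lbound; exists (maxn k K) => //=; rewrite leq_maxl.
by apply: KP => //; rewrite (leq_trans _ (nk _))// leq_maxr.
Qed.

End L2_completeness.

(** * Fourier multipliers *)

Section multipliers.
Variable R : realType.
Local Notation V := ((2 * pi) ^+ 2 : R).
Local Notation sq := (@sqint _ _ R (torus R)).
Implicit Types (c s a b : int * int -> R) (f g h : plane R -> R) (k : int * int) (N : nat).

Lemma V_gt0 : 0 < V.
Proof. by rewrite exprn_gt0// mulr_gt0// pi_gt0. Qed.

(** Expand t (g - h / t)^2 >= 0. This stands in for Minkowski's inequality without square roots: the
    error h is made small for fixed t, and t is then sent to 0. *)
Lemma sqintD_weighted g h (t : R) : 0 < t ->
  measurable_fun setT g -> measurable_fun setT h ->
  (sq (fun x => (g x + h x)%R) <= (1 + t)%:E * sq g + (1 + t^-1)%:E * sq h)%E.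
Proof.
move=> t0 mg mh.
have t1 : 0 <= 1 + t by rewrite addr_ge0// ltW.
have t2 : 0 <= 1 + t^-1 by rewrite addr_ge0// invr_ge0 ltW.
rewrite /sqint -!ge0_integralZl_EFin//;
  try by [move=> x _; rewrite lee_fin sqr_ge0|exact: measurable_sqr].
rewrite -ge0_integralD//;
  try by [move=> x _; rewrite -EFinM lee_fin mulr_ge0// sqr_ge0
         |by apply: measurable_funeM; exact: measurable_sqr].
apply: ge0_le_integral => //.
- by move=> x _; rewrite lee_fin sqr_ge0.
- by apply: measurable_sqr; exact: measurable_funD.
- by apply: emeasurable_funD; apply: measurable_funeM; exact: measurable_sqr.
- move=> x _; rewrite -!EFinM -EFinD lee_fin.
  have : 0 <= t * (g x - t^-1 * h x) ^+ 2 by rewrite mulr_ge0 ?sqr_ge0// ltW.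
  rewrite (_ : t * _ = (1 + t) * g x ^+ 2 + (1 + t^-1) * h x ^+ 2 - (g x + h x) ^+ 2).
    by rewrite subr_ge0.
  by field; rewrite gt_eqF.
Qed.

Lemma sqintN h : sq (fun x => - h x) = sq h.
Proof. by apply: eq_integral => x _; rewrite sqrrN. Qed.

Lemma sqintB_sym g h : sq (fun x => g x - h x) = sq (fun x => h x - g x).
Proof. by apply: eq_integral => x _; rewrite -sqrrN opprB. Qed.

Lemma normL2_sq h : normL 2 h = (sq h `^ 2^-1)%E.
Proof.
rewrite /normL unlock /Lnorm; congr (_ `^ _)%E; apply: eq_integral => x _ /=.
by rewrite powR_mulrn// real_normK// num_real.
Qed.

Lemma normL2_sqr h : (normL 2 h ^+ 2 = sq h)%E.
Proof.
rewrite normL2_sq poweR12_sqrt ?sqint_ge0// sqr_sqrte//; exact: sqint_ge0.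
Qed.

Lemma normL2_lt h (r : R) : 0 < r -> (normL 2 h < r%:E)%E <-> (sq h < (r ^+ 2)%:E)%E.
Proof.
move=> r0; rewrite normL2_sq poweR12_sqrt ?sqint_ge0//.
have := sqint_ge0 (torus R) h.
case: (sq h) => [x| |] //; rewrite lee_fin => x0 /=; rewrite !lte_fin.
by rewrite -[X in Num.sqrt _ < X](ger0_norm (ltW r0)) -sqrtr_sqr ltr_sqrt// exprn_gt0.
Qed.

Lemma normL2_cvg0 (h : nat -> plane R -> R) :
  (fun n => normL 2 (h n)) @ \oo --> 0%E <->
  forall e : R, 0 < e -> exists N, forall n, (N <= n)%N -> (sq (h n) <= e%:E)%E.
Proof.
split.
  move=> h0 e e0.
  have se : 0 < Num.sqrt e by rewrite sqrtr_gt0.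
  suff [N _ NP] : \forall n \near \oo, (sq (h n) <= e%:E)%E by exists N.
  move/fine_cvgP : h0 => [fh].
  move=> /cvgrPdist_lt /(_ _ se) fh0.
  near=> n; rewrite ltW// -(sqr_sqrtr (ltW e0)); apply/normL2_lt => //.
  have fn : normL 2 (h n) \is a fin_num by near: n.
  rewrite -(fineK fn) lte_fin; apply: le_lt_trans (ler_norm _) _.
  by rewrite -normrN -sub0r; near: n.
move=> H; apply/fine_cvgP; split.
  have [N NP] := H 1 ltr01; exists N => // n Nn.
  rewrite ge0_fin_numE ?Lnorm_ge0//.
  apply: (@lt_trans _ _ 2%:E); last exact: ltry.
  by apply/normL2_lt => //; rewrite (le_lt_trans (NP _ Nn))// lte_fin -natrX ltr1n.
apply/cvgrPdist_lt => e e0.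
have [N NP] := H ((e / 2) ^+ 2) (exprn_gt0 _ (divr_gt0 e0 (ltr0Sn _ 1))).
exists N => // n Nn; rewrite sub0r normrN ger0_norm ?fine_ge0 ?Lnorm_ge0//=.
rewrite -lte_fin fineK; last first.
  rewrite ge0_fin_numE ?Lnorm_ge0//; apply: (@lt_trans _ _ e%:E); last exact: ltry.
  apply/normL2_lt => //; rewrite (le_lt_trans (NP _ Nn))// lte_fin.
  by rewrite ltrXn2r// ?ltW// ?divr_gt0//; lra.
apply/normL2_lt => //; rewrite (le_lt_trans (NP _ Nn))// lte_fin.
by rewrite ltrXn2r// ?ltW// ?divr_gt0//; lra.
Unshelve. all: by end_near. Qed.

Lemma in_L2P h : in_L2 h <-> measurable_fun setT h /\ (sq h < +oo)%E.
Proof.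
rewrite /in_L2 inE; split.
  move=> /andP[]; rewrite !inE /= /finite_norm => mh.
  rewrite -/(normL 2 h) normL2_sq => nh; split => //.
  by apply: lty_poweRy nh; rewrite invr_eq0.
move=> [mh sh]; apply/andP; rewrite !inE; split => //=.
by rewrite /finite_norm -/(normL 2 h) normL2_sq poweR_lty.
Qed.

Lemma sqint_trig c s N : hermitian_coef c s ->
  sq (trig c s N) = (V * \sum_(k <- box N) (c k ^+ 2 + s k ^+ 2))%:E.
Proof.
move=> cs; rewrite -Parseval// /Rintegral fineK//.
apply: (integrable_fin_num measurableT); apply: bmfun_integrable.
under eq_fun do rewrite expr2.
by apply: bmfunM; exact: bmfun_trig.
Qed.

Definition energy c s N : R := \sum_(k <- box N) (c k ^+ 2 + s k ^+ 2).

Lemma energy_mask c s M N : (M <= N)%N ->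
  energy (fun k => (k \notin box M)%:R * c k) (fun k => (k \notin box M)%:R * s k) N =
  energy c s N - energy c s M.
Proof.
move=> MN; rewrite /energy.
rewrite (big_box_sub _ MN).
rewrite [in RHS](bigID (fun k => k \in box M))/= [RHS]addrAC subrr add0r [RHS]big_mkcond/=.
apply: eq_bigr => k _.
by case: (k \in box M) => /=; rewrite ?mul0r ?mul1r ?expr0n ?addr0.
Qed.

Lemma energy_ge0 c s N : 0 <= energy c s N.
Proof. by apply: sumr_ge0 => k _; rewrite addr_ge0// sqr_ge0. Qed.

Lemma energy_le c s M N : (M <= N)%N -> energy c s M <= energy c s N.
Proof. by move=> MN; rewrite -subr_ge0 -energy_mask// energy_ge0. Qed.

Lemma sqint_trigB c s M N : hermitian_coef c s -> (M <= N)%N ->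
  sq (fun x => trig c s N x - trig c s M x) = (V * (energy c s N - energy c s M))%:E.
Proof.
move=> cs MN; rewrite -energy_mask// -sqint_trig; last exact: hermitian_mask.
by congr sqint; apply/funext => x; rewrite trigB.
Qed.

Lemma measurable_trig c s N : measurable_fun setT (@trig R c s N).
Proof. exact: (bmfun_trig c s N).1. Qed.

(** The energies are nondecreasing and bounded, hence Cauchy near their supremum; by Parseval their
    increments are, up to the factor V, the squared distances between partial sums. *)
Lemma trig_cvg c s (B : R) : hermitian_coef c s -> (forall N, energy c s N <= B) ->
  exists g, in_L2 g /\ forall e : R, 0 < e -> exists N, forall n, (N <= n)%N ->
      (sq (fun x => (g x - trig c s n x)%R) <= e%:E)%E.
Proof.
move=> cs EB.
pose A := range (energy c s).
have supA : has_sup A by split; [exists (energy c s 0); exists 0|exists B => _ [N _ <-]].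
have [||g [mg gP]] := @L2_complete _ _ R (torus R) (@torus_fin R) (trig c s).
- by move=> n; exact: measurable_trig.
- move=> e e0.
  have [_ [N _ <-] NP] := sup_adherent (divr_gt0 e0 V_gt0) supA.
  have H m n : (N <= m)%N -> (m <= n)%N ->
      (sq (fun x => (trig c s n x - trig c s m x)%R) <= e%:E)%E.
    move=> Nm mn; rewrite sqint_trigB// lee_fin mulrC -ler_pdivlMr ?V_gt0//.
    have : energy c s n <= sup A by apply: sup_upper_bound => //; exists n.
    by have := energy_le c s Nm; lra.
  exists N => m n Nm Nn; have [mn|/ltnW nm] := leqP m n; last exact: H.
  by rewrite sqintB_sym; exact: H.
exists g; split => //; apply/in_L2P; split => //.
have [N NP] := gP 1 ltr01.
have -> : g = fun x => trig c s N x + (g x - trig c s N x) by apply/funext => x; rewrite addrC subrK.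
apply: le_lt_trans (sqintD_weighted ltr01 (measurable_trig _ _ _) _) _.
  by apply: measurable_funB => //; exact: measurable_trig.
rewrite sqint_trig//; apply: le_lt_trans (leeD (lexx _) (lee_pmul _ _ (lexx _) (NP N _))) _ => //.
  exact: sqint_ge0.
by rewrite -!EFinM -EFinD ltry.
Qed.

(** Closes the arguments based on [sqintD_weighted]: t is chosen from y, then the error from t, so
    that each excess is at most half of the given tolerance. *)
Lemma le_weighted_limit (x y : R) : 0 <= y ->
  (forall t e : R, 0 < t -> 0 < e -> x <= (1 + t) * y + (1 + t^-1) * e) -> x <= y.
Proof.
move=> y0 H; apply/ler_addgt0Pr => e e0.
pose t := e / (2 * (y + 1)).
have y1 : 0 < y + 1 by lra.
have t0 : 0 < t by rewrite divr_gt0// mulr_gt0.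
have e' : 0 < e / (2 * (1 + t^-1)) by rewrite divr_gt0// mulr_gt0// addr_gt0// invr_gt0.
apply: le_trans (H t _ t0 e') _.
have -> : (1 + t^-1) * (e / (2 * (1 + t^-1))) = e / 2.
  have : 1 + t^-1 != 0 by rewrite gt_eqF// addr_gt0// invr_gt0.
  by move: (1 + _) => z z0; field.
have : t * y <= e / 2.
  rewrite /t mulrAC ler_pdivrMr ?mulr_gt0// ; nra.
by lra.
Qed.

Section symbol.
Variables a b : int * int -> R.
Hypotheses (a_even : forall k, a (- k) = a k) (b_odd : forall k, b (- k) = - b k).
Local Notation E f := (energy (mult_cos a b f) (mult_sin a b f)).

Lemma is_multiplierP f g : is_multiplier a b f g <-> in_L2 g /\
  forall e : R, 0 < e -> exists N, forall n, (N <= n)%N ->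
    (sq (fun x => (g x - trig (mult_cos a b f) (mult_sin a b f) n x)%R) <= e%:E)%E.
Proof.
rewrite /is_multiplier; have -> : (fun N => normL 2 (fsub g (multiplier_sum a b f N))) =
    (fun N => normL 2 (fun x => g x - trig (mult_cos a b f) (mult_sin a b f) N x)).
  by apply/funext => N; rewrite multiplier_sumE.
by split=> -[gL2 /normL2_cvg0].
Qed.

Lemma exists_multiplier f (B : R) : (forall N, E f N <= B) ->
  exists g, is_multiplier a b f g.
Proof.
move=> EB; have [g gP] := trig_cvg (hermitian_mult f a_even b_odd) EB.
by exists g; apply/is_multiplierP.
Qed.

Lemma energy_le_sqint f g N : is_multiplier a b f g -> ((V * E f N)%:E <= sq g)%E.
Proof.
move=> /is_multiplierP[/in_L2P[mg sg] gP].
have cs := hermitian_mult f a_even b_odd.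
have sgf : sq g \is a fin_num by rewrite ge0_fin_numE// sqint_ge0.
rewrite -(fineK sgf) lee_fin; apply: le_weighted_limit.
  by rewrite fine_ge0// sqint_ge0.
move=> t e t0 e0; have [M MP] := gP e e0.
pose n := maxn M N; set u := trig _ _ in MP.
have : ((V * E f n)%:E <= (1 + t)%:E * sq g + (1 + t^-1)%:E * e%:E)%E.
  rewrite -[leLHS](sqint_trig n cs) -/u.
  have -> : u n = fun x => g x + (u n x - g x) by apply/funext => x; rewrite addrC subrK.
  apply: le_trans (sqintD_weighted t0 mg _) _.
    by apply: measurable_funB => //; exact: measurable_trig.
  apply: leeD => //; apply: lee_pmul => //; first by rewrite lee_fin addr_ge0// invr_ge0 ltW.
    exact: sqint_ge0.
  by rewrite sqintB_sym; apply: MP; rewrite leq_maxl.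
rewrite -(fineK sgf) -!EFinM -EFinD lee_fin; apply: le_trans.
by rewrite ler_wpM2l ?(ltW V_gt0)//; apply: energy_le; rewrite leq_maxr.
Qed.

(** Parseval in the limit: the norm of an image known only up to null sets becomes a supremum of
    finite sums of Fourier coefficients of f. *)
Lemma sqint_multiplier f g : is_multiplier a b f g ->
  sq g = ereal_sup (range (fun N => (V * E f N)%:E)).
Proof.
move=> gP'; apply/eqP; rewrite eq_le; apply/andP; split; last first.
  by apply: ge_ereal_sup => _ [N _ <-]; exact: energy_le_sqint.
have := gP' => /is_multiplierP[/in_L2P[mg sg] gP].
have cs := hermitian_mult f a_even b_odd.
set S := ereal_sup _.
have ES N : ((V * E f N)%:E <= S)%E by apply: ereal_sup_ubound; exists N.
have S0 : (0 <= S)%E by apply: le_trans (ES 0%N); rewrite lee_fin mulr_ge0 ?(ltW V_gt0)// energy_ge0.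
have Sf : S \is a fin_num.
  rewrite ge0_fin_numE//; apply: le_lt_trans sg.
  by apply: ge_ereal_sup => _ [N _ <-]; exact: energy_le_sqint.
have sgf : sq g \is a fin_num by rewrite ge0_fin_numE// sqint_ge0.
rewrite -(fineK sgf) -(fineK Sf) lee_fin; apply: le_weighted_limit.
  by rewrite fine_ge0.
move=> t e t0 e0; have [n nP] := gP e e0.
set u := trig _ _ in nP.
rewrite -lee_fin fineK// EFinD !EFinM fineK//.
have -> : g = fun x => u n x + (g x - u n x) by apply/funext => x; rewrite addrC subrK.
apply: le_trans (sqintD_weighted t0 _ _) _.
- exact: measurable_trig.
- by apply: measurable_funB => //; exact: measurable_trig.
- apply: leeD; (apply: lee_pmul => //; [|exact: sqint_ge0|]).
  + by rewrite lee_fin addr_ge0// ltW.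
  + by rewrite /u (sqint_trig n cs); exact: ES.
  + by rewrite lee_fin addr_ge0// invr_ge0 ltW.
  + exact: nP.
Qed.

End symbol.

End multipliers.

(** * Fourier coefficients of multiplier images, and Sobolev norms as suprema of energies *)

Section coefficients.
Variable R : realType.
Local Notation V := ((2 * pi) ^+ 2 : R).
Local Notation sq := (@sqint _ _ R (torus R)).
Implicit Types (c s a b : int * int -> R) (f g h : plane R -> R) (k : int * int) (N : nat).

Lemma in_L2_integrable h phi : in_L2 h -> bmfun phi ->
  (torus R).-integrable setT (EFin \o (fun x => h x * phi x)).
Proof.
move=> /in_L2P[mh sh] [mphi [M phiM]].
have ih : (torus R).-integrable setT (EFin \o h).
  apply/integrableP; split; first exact/measurable_EFinP.
  apply: le_lt_trans (integral_norm_le_sqint (torus R) mh ltr01) _.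
  by rewrite torus_setT lte_add_pinfty// lte_mul_pinfty// ?lee_fin ?invr1// ltry.
have -> : EFin \o (fun x => h x * phi x) = (fun x => (h x)%:E * (phi x)%:E)%E by [].
apply: integrableMl => //.
exists M; split; first exact: num_real.
by move=> r Mr x _; exact: le_trans (phiM x) (ltW Mr).
Qed.

Lemma in_L2_bm h : bmfun h -> in_L2 h.
Proof.
move=> bh; apply/in_L2P; split; first exact: bh.1.
have bh2 : bmfun (fun x => h x ^+ 2) by under eq_fun do rewrite expr2; exact: bmfunM.
have /integrableP[_] := bmfun_integrable bh2.
apply: le_lt_trans; apply: ge0_le_integral => //.
- by move=> x _; rewrite lee_fin sqr_ge0.
- by apply: measurable_sqr; exact: bh.1.
- by apply/measurable_EFinP; apply: measurableT_comp => //; exact: bh2.1.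
- by move=> x _; rewrite /= lee_fin ler_norm.
Qed.

Lemma in_L2B g h : in_L2 g -> in_L2 h -> in_L2 (fsub g h).
Proof.
move=> /in_L2P[mg sg] /in_L2P[mh sh]; apply/in_L2P; split.
  exact: measurable_funB.
apply: le_lt_trans (sqintD_weighted ltr01 mg (_ : measurable_fun setT (fun x => - h x))) _.
  exact: measurableT_comp.
by rewrite sqintN lte_add_pinfty// lte_mul_pinfty ?lee_fin// ge0_fin_numE// sqint_ge0.
Qed.

Lemma in_L2_L2 (f : L2 R) : in_L2 f.
Proof.
apply/in_L2P; split.
  exact: (@measurable_funPT _ _ _ _ (repr (L2_class f : {mfun_ torus R, plane R >-> measurableTypeR R}))).
have := @Lebesgue_finite _ _ R (torus R) _ (lee1n 2) (L2_class f).
rewrite /finite_norm -/(normL 2 _) normL2_sq.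
by apply: lty_poweRy; rewrite invr_eq0.
Qed.

Lemma dotBl g h phi : in_L2 g -> in_L2 h -> bmfun phi ->
  dot (fsub g h) phi = dot g phi - dot h phi.
Proof.
move=> gL hL bphi; rewrite /dot /fsub -RintegralB//; try exact: in_L2_integrable.
by apply: eq_Rintegral => x _; rewrite mulrBl.
Qed.

Lemma dot_le h phi (r e : R) : in_L2 h -> bmfun phi -> (forall x, `|phi x| <= 1) ->
  0 < r -> (sq h <= e%:E)%E -> `|dot h phi| <= r^-1 * e + r * V.
Proof.
move=> hL bphi phi1 r0 se; have /in_L2P[mh _] := hL.
apply: le_trans (le_normr_Rintegral measurableT (in_L2_integrable hL bphi)) _.
rewrite -lee_fin /Rintegral fineK; last first.
  apply: (integrable_fin_num measurableT).
  exact: integrable_norm (in_L2_integrable hL bphi).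
apply: (@le_trans _ _ (\int[torus R]_x (`|h x|)%:E)%E).
  apply: ge0_le_integral => //.
  - apply/measurable_EFinP; apply: measurableT_comp => //.
    exact: measurable_funM mh bphi.1.
  - by apply/measurable_EFinP; apply: measurableT_comp.
  - by move=> x _; rewrite lee_fin normrM ler_piMr.
apply: le_trans (integral_norm_le_sqint (torus R) mh r0) _.
rewrite torus_setT EFinD !EFinM; apply: leeD => //.
by apply: lee_pmul => //; rewrite ?lee_fin ?invr_ge0 ?(ltW r0)// sqint_ge0.
Qed.

Lemma dot_small (phi : plane R -> R) (e : R) : bmfun phi -> (forall x, `|phi x| <= 1) ->
  0 < e -> exists2 r : R, 0 < r & forall h, in_L2 h -> (sq h <= r%:E)%E -> `|dot h phi| < e.
Proof.
move=> bphi phi1 e0; have V0 := V_gt0 R.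
(* Both terms of [dot_le] become e / 4. *)
pose r := e / (4 * V).
have r0 : 0 < r by rewrite divr_gt0// mulr_gt0.
exists (r * (e / 4)); first by rewrite mulr_gt0// divr_gt0.
move=> h hL sh; apply: le_lt_trans (dot_le hL bphi phi1 r0 sh) _.
rewrite mulKf ?gt_eqF// /r.
have -> : e / (4 * V) * V = e / 4 by move: V0; move: V => v v0; field; rewrite gt_eqF.
by lra.
Qed.

Section symbol.
Variables a b : int * int -> R.
Hypotheses (a_even : forall k, a (- k) = a k) (b_odd : forall k, b (- k) = - b k).

(** Pairing with phi is L^2-continuous, and along the partial sums it is eventually constant; for
    phi a cosine or a sine the constant is V times a coefficient. *)
Lemma dot_multiplier f g phi (l : R) N : is_multiplier a b f g -> bmfun phi ->
  (forall x, `|phi x| <= 1) ->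
  (forall n, (N <= n)%N -> dot (trig (mult_cos a b f) (mult_sin a b f) n) phi = l) ->
  dot g phi = l.
Proof.
move=> /is_multiplierP[gL gP] bphi phi1 ul.
apply/eqP; rewrite -subr_eq0 -normr_le0; apply/ler_addgt0Pr => e e0; rewrite add0r.
have [r r0 rP] := dot_small bphi phi1 e0; have [M MP] := gP r r0.
rewrite -(ul (maxn M N)) ?leq_maxr//.
have tL := in_L2_bm (bmfun_trig (mult_cos a b f) (mult_sin a b f) (maxn M N)).
rewrite -dotBl//; apply/ltW/rP; first exact: in_L2B.
by apply: MP; rewrite leq_maxl.
Qed.

Lemma in_box_ge k n : (maxn `|k.1|%N `|k.2|%N <= n)%N -> k \in box n.
Proof. by rewrite mem_box geq_max. Qed.

Lemma cos_coef_multiplier f g k : is_multiplier a b f g ->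
  cos_coef g k = mult_cos a b f k.
Proof.
move=> gP; have V0 : V != 0 by rewrite gt_eqF// V_gt0.
rewrite /cos_coef (@dot_multiplier f g _ (V * mult_cos a b f k) (maxn `|k.1|%N `|k.2|%N))//.
- by rewrite mulrAC mulfV// mul1r.
- exact: bmfun_cos.
- by move=> x; exact: cos_max.
- move=> n kn; rewrite /dot Rintegral_trig_cos; last exact: hermitian_mult.
  by rewrite in_box_ge// mul1r.
Qed.

Lemma sin_coef_multiplier f g k : is_multiplier a b f g ->
  sin_coef g k = mult_sin a b f k.
Proof.
move=> gP; have V0 : V != 0 by rewrite gt_eqF// V_gt0.
rewrite /sin_coef (@dot_multiplier f g _ (V * mult_sin a b f k) (maxn `|k.1|%N `|k.2|%N))//.
- by rewrite mulrAC mulfV// mul1r.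
- exact: bmfun_sin.
- by move=> x; exact: sin_max.
- move=> n kn; rewrite /dot Rintegral_trig_sin; last exact: hermitian_mult.
  by rewrite in_box_ge// mul1r.
Qed.

Lemma multiplierP f : (exists g, is_multiplier a b f g) ->
  is_multiplier a b f (multiplier a b f).
Proof.
move=> [g gP].
exact: (@xgetPex _ (cst 0) [set g | is_multiplier a b f g] (ex_intro _ g gP)).
Qed.

End symbol.

Lemma lap_symbol_even (s : R) k : lap_symbol s (- k) = lap_symbol s k.
Proof. by rewrite /lap_symbol /= !intrN !sqrrN. Qed.

Definition coef_sq f k : R := cos_coef f k ^+ 2 + sin_coef f k ^+ 2.

Lemma coef_sq_ge0 f k : 0 <= coef_sq f k.
Proof. by rewrite addr_ge0// sqr_ge0. Qed.

Definition wenergy (w : int * int -> R) f N : R :=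
  \sum_(k <- box N) w k * coef_sq f k.

(* The squared L^2 norm of the image of f under a multiplier whose symbol has
   squared modulus w, and +oo when f is not in its domain. *)
Definition wsup (w : int * int -> R) f : \bar R :=
  ereal_sup (range (fun N => (V * wenergy w f N)%:E)).

Lemma energy_mult a b f N : energy (mult_cos a b f) (mult_sin a b f) N =
  wenergy (fun k => a k ^+ 2 + b k ^+ 2) f N.
Proof.
by apply: eq_bigr => k _; rewrite /mult_cos /mult_sin /coef_sq; ring.
Qed.

Lemma exists_multiplierE a b f : (forall k, a (- k) = a k) -> (forall k, b (- k) = - b k) ->
  (exists g, is_multiplier a b f g) <->
  (wsup (fun k => (a k ^+ 2 + b k ^+ 2)%R) f < +oo)%E.
Proof.
move=> ae bo; split=> [[g gP]|Sy].
  have := gP => /is_multiplierP[/in_L2P[_ sg] _].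
  rewrite (sqint_multiplier ae bo gP) in sg; apply: le_lt_trans sg.
  by rewrite /wsup; under eq_fun do rewrite -energy_mult.
set S := wsup _ _ in Sy.
have ES N : ((V * wenergy (fun k => a k ^+ 2 + b k ^+ 2) f N)%:E <= S)%E.
  by apply: ereal_sup_ubound; exists N.
have Sf : S \is a fin_num.
  rewrite fin_numElt Sy andbT; exact: lt_le_trans (ltNyr _) (ES 0%N).
apply: (exists_multiplier ae bo (B := fine S / V)) => N.
by rewrite ler_pdivlMr ?V_gt0// mulrC energy_mult -lee_fin fineK.
Qed.

Lemma sqint_multiplierE a b f : (forall k, a (- k) = a k) -> (forall k, b (- k) = - b k) ->
  (exists g, is_multiplier a b f g) ->
  sq (multiplier a b f) = wsup (fun k => a k ^+ 2 + b k ^+ 2) f.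
Proof.
move=> ae bo gP; rewrite (sqint_multiplier ae bo (multiplierP gP)).
by rewrite /wsup; under eq_fun do rewrite energy_mult.
Qed.

Definition lap_weight (s : R) k : R := lap_symbol (s / 2) k ^+ 2.

(** The value +oo outside the domain matches the supremum of unbounded energies, so the identity
    holds for every f. *)
Lemma normH_sqr (s : R) f : (normH s f ^+ 2 = wsup (lap_weight s) f)%E.
Proof.
have E : lap_weight s =
    fun k => lap_symbol (s / 2) k ^+ 2 + (cst 0 : int * int -> R) k ^+ 2.
  by apply/funext => k; rewrite /lap_weight expr0n addr0.
rewrite E /normH; case: asboolP => [gP|ngP].
  rewrite normL2_sqr; apply: sqint_multiplierE => //; first exact: lap_symbol_even.
  by move=> k; rewrite oppr0.
set S := wsup _ _; have [|] := ltP S +oo%E.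
  move=> /exists_multiplierE; move=> /(_ (lap_symbol_even _)).
  by move=> /(_ (fun _ => esym (oppr0 _))) /ngP.
by rewrite leye_eq => /eqP ->.
Qed.

Lemma normH_ge0 (s : R) f : (0 <= normH s f)%E.
Proof. by rewrite /normH; case: asboolP => // _; exact: Lnorm_ge0. Qed.

End coefficients.

(** * Truncation *)

Lemma emeasurable_fun_sup d (T : measurableType d) (R : realType) (f : nat -> T -> \bar R) :
  (forall n, measurable_fun setT (f n)) ->
  measurable_fun setT (fun x => ereal_sup (range (f ^~ x))).
Proof.
move=> mf; have -> : (fun x => ereal_sup (range (f ^~ x))) = (fun x => esups (f ^~ x) 0%N).
  by apply/funext => x; rewrite /esups /=; congr ereal_sup; apply/seteqP; split => _ [n _ <-]; exists n.
exact: measurable_fun_esups.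
Qed.

Section truncation.
Context d (T : measurableType d) (R : realType) (mu : {measure set T -> \bar R}).
Implicit Types h : T -> R.

Definition trunc_sqint h (M : nat) : \bar R :=
  (\int[mu]_x ((Num.min (h x) M%:R) ^+ 2)%:E)%E.

Lemma measurable_trunc h (M : nat) : measurable_fun setT h ->
  measurable_fun setT (fun x => ((Num.min (h x) M%:R) ^+ 2)%:E).
Proof. by move=> mh; apply: measurable_sqr; exact: measurable_minr. Qed.

Lemma trunc_sqint_le h M : measurable_fun setT h -> (forall x, 0 <= h x) ->
  (trunc_sqint h M <= sqint mu h)%E.
Proof.
move=> mh h0; apply: ge0_le_integral => //.
- by move=> x _; rewrite lee_fin sqr_ge0.
- exact: measurable_trunc.
- exact: measurable_sqr.
- move=> x _; rewrite lee_fin lerXn2r// ?nnegrE ?le_min ?h0//=.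
  by rewrite ge_min lexx.
Qed.

Lemma trunc_sqint_sup h : measurable_fun setT h -> (forall x, 0 <= h x) ->
  ereal_sup (range (trunc_sqint h)) = sqint mu h.
Proof.
move=> mh h0.
have nd x : nondecreasing_seq (fun M : nat => ((Num.min (h x) M%:R) ^+ 2)%:E).
  move=> m n mn; rewrite lee_fin lerXn2r// ?nnegrE ?le_min ?h0//=.
  by rewrite ge_min lexx/= ge_min ler_nat mn orbT.
have ndI : nondecreasing_seq (trunc_sqint h).
  move=> m n mn; apply: ge0_le_integral => //.
  - by move=> x _; rewrite lee_fin sqr_ge0.
  - exact: measurable_trunc.
  - exact: measurable_trunc.
  - by move=> x _; exact: nd.
have := ereal_nondecreasing_cvgn ndI => /cvg_lim <- //.
have p0 (M : nat) (x : T) : setT x -> (0 <= ((Num.min (h x) M%:R) ^+ 2)%:E)%E.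
  by move=> _; rewrite lee_fin sqr_ge0.
rewrite /trunc_sqint -(@monotone_convergence _ _ _ mu _ measurableT
  (fun (M : nat) x => ((Num.min (h x) M%:R) ^+ 2)%:E)
  (fun M => measurable_trunc M mh) p0 (fun x _ => nd x)).
apply: eq_integral => x _; apply/cvg_lim => //.
apply: cvg_near_cst; exists (Num.bound (h x)) => // n /= hn.
rewrite min_l// (le_trans (ltW (archi_boundP (h0 x))))// ler_nat; exact: hn.
Qed.

Hypothesis mu_fin : (mu setT < +oo)%E.

(** On nonnegative numbers, squaring after truncation at M is 2M-Lipschitz. *)
Lemma trunc_sqint_lip h1 h2 (M : nat) : measurable_fun setT h1 -> measurable_fun setT h2 ->
  (forall x, 0 <= h1 x) -> (forall x, 0 <= h2 x) ->
  (trunc_sqint h1 M <= trunc_sqint h2 M + (2 * M%:R)%:E * \int[mu]_x (`|h1 x - h2 x|)%:E)%E.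
Proof.
move=> m1 m2 p1 p2.
have md : measurable_fun setT (fun x => (`|h1 x - h2 x|)%:E).
  by apply/measurable_EFinP; apply: measurableT_comp => //; exact: measurable_funB.
rewrite -ge0_integralZl_EFin ?mulr_ge0// -ge0_integralD//;
  try by [exact: measurable_funeM|exact: measurable_trunc
         |move=> x _; rewrite lee_fin sqr_ge0|move=> x _; rewrite -EFinM lee_fin mulr_ge0].
apply: ge0_le_integral => //.
- by move=> x _; rewrite lee_fin sqr_ge0.
- exact: measurable_trunc.
- by apply: emeasurable_funD; [exact: measurable_trunc|exact: measurable_funeM].
- move=> x _; rewrite -EFinM -EFinD lee_fin.
  have M0 : (0 : R) <= M%:R by [].
  have := p1 x; have := p2 x; move: (h1 x) (h2 x) M%:R M0 => a b m m0 b0 a0.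
  have [ab|ab] := ltP a b.
    apply: (@le_trans _ _ (Num.min b m ^+ 2)).
      rewrite lerXn2r// ?nnegrE ?le_min ?a0 ?b0 ?m0//=.
      by rewrite !ge_min lexx (ltW ab) orbT.
    by rewrite lerDl mulr_ge0// mulr_ge0.
  rewrite ger0_norm ?subr_ge0// /Num.min; case: ifPn; case: ifPn; rewrite -?leNgt; nra.
Qed.

Lemma trunc_sqint_fin h M : measurable_fun setT h -> (forall x, 0 <= h x) ->
  trunc_sqint h M \is a fin_num.
Proof.
move=> mh h0; rewrite ge0_fin_numE; last by apply: integral_ge0 => x _; rewrite lee_fin sqr_ge0.
apply: (@le_lt_trans _ _ (\int[mu]_x (M%:R ^+ 2)%:E)%E).
  apply: ge0_le_integral => //.
  - by move=> x _; rewrite lee_fin sqr_ge0.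
  - exact: measurable_trunc.
  - move=> x _; rewrite lee_fin lerXn2r// ?nnegrE ?le_min ?h0//=.
    by rewrite ge_min lexx orbT.
rewrite integral_cst// lte_mul_pinfty ?lee_fin ?sqr_ge0//.
Qed.

Variables (u : nat -> T -> R) (g : T -> R).
Hypotheses (mu_ : forall n, measurable_fun setT (u n)) (mg : measurable_fun setT g).
Hypotheses (u0 : forall n x, 0 <= u n x) (g0 : forall x, 0 <= g x).
Hypothesis ug : forall e : R, 0 < e -> exists N, forall n, (N <= n)%N ->
  (\int[mu]_x (`|g x - u n x|)%:E <= e%:E)%E.

Lemma trunc_sqint_cvg M : trunc_sqint (u n) M @[n --> \oo] --> trunc_sqint g M.
Proof.
rewrite -(fineK (trunc_sqint_fin M mg g0)).
apply/fine_cvgP; split.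
  by apply: nearW => n; exact: trunc_sqint_fin.
apply/cvgrPdist_le => e e0.
have M2 : 0 < 2 * (M%:R + 1) :> R by rewrite mulr_gt0// ltr_wpDl.
have [N NP] := ug (divr_gt0 e0 M2).
exists N => // n Nn /=.
have D : ((2 * M%:R)%:E * \int[mu]_x (`|g x - u n x|)%:E <= e%:E)%E.
  apply: le_trans (lee_pmul _ _ (lexx _) (NP n Nn)) _.
  - by rewrite lee_fin mulr_ge0.
  - by apply: integral_ge0 => x _; rewrite lee_fin.
  - rewrite -EFinM lee_fin mulrCA ler_piMr ?(ltW e0)// ler_pdivrMr// mul1r.
    by rewrite ler_pM2l// lerDl.
have D' : (\int[mu]_x (`|u n x - g x|)%:E = \int[mu]_x (`|g x - u n x|)%:E)%E.
  by apply: eq_integral => x _; rewrite distrC.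
rewrite ler_distl; apply/andP; split.
- rewrite lerBlDr -lee_fin EFinD !fineK ?trunc_sqint_fin//.
  apply: le_trans (trunc_sqint_lip M (mu_ n) mg (u0 n) g0) _.
  by rewrite D' leeD.
- rewrite -lee_fin EFinD !fineK ?trunc_sqint_fin//.
  by apply: le_trans (trunc_sqint_lip M mg (mu_ n) g0 (u0 n)) _; rewrite leeD.
Qed.

(** Lower semicontinuity under L^1 convergence: each truncated integral passes to the limit, and the
    supremum over truncations restores the full one. Bounds at arbitrarily large n suffice, which
    suits estimates available only at powers of 4. *)
Lemma sqint_cvg_le (C : \bar R) : (forall N, exists2 n, (N <= n)%N & (sqint mu (u n) <= C)%E) ->
  (sqint mu g <= C)%E.
Proof.
move=> uC; rewrite -trunc_sqint_sup//; apply: ge_ereal_sup => _ [M _ <-].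
rewrite leNgt; apply/negP => CM.
have Mf := trunc_sqint_fin M mg g0.
have := @trunc_sqint_cvg M; rewrite -(fineK Mf) => /fine_cvgP[_ /cvgrPdist_lt cM].
have [n0 _ n0C] := uC 0%N.
have C0 : (0 <= C)%E by exact: le_trans (sqint_ge0 _ _) n0C.
have Cf : C \is a fin_num by rewrite ge0_fin_numE// (lt_trans CM)// ltey_eq Mf.
have e0 : 0 < fine (trunc_sqint g M) - fine C by rewrite subr_gt0 -lte_fin !fineK.
have [N _ NP] := cM _ e0; have [n Nn nC] := uC N.
have := NP n Nn => /=; rewrite ltr_distl => /andP[_ H].
have : (trunc_sqint (u n) M <= C)%E by apply: le_trans nC; exact: trunc_sqint_le.
have uf : trunc_sqint (u n) M \is a fin_num by exact: trunc_sqint_fin.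
rewrite -(fineK uf) -(fineK Cf) lee_fin => K; move: H => /=; lra.
Qed.

End truncation.

Section square_convergence.
Context d (T : measurableType d) (R : realType) (mu : {measure set T -> \bar R}).

(** Young's inequality applied to p^2 - q^2 = 2 p (p - q) - (p - q)^2 gives |p^2 - q^2| <= (1 + 1/t)
    (p - q)^2 + t p^2; t is fixed by the norm of g, and then n by t. *)
Lemma sqr_cvg_L1 (u : nat -> T -> R) (g : T -> R) : (forall n, measurable_fun setT (u n)) ->
  measurable_fun setT g -> (sqint mu g < +oo)%E ->
  (forall e : R, 0 < e -> exists N, forall n, (N <= n)%N ->
    (sqint mu (fun x => g x - u n x)%R <= e%:E)%E) ->
  forall e : R, 0 < e -> exists N, forall n, (N <= n)%N ->
    (\int[mu]_x (`|g x ^+ 2 - u n x ^+ 2|)%:E <= e%:E)%E.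
Proof.
move=> mu_ mg sg ug e e0.
have sgf : sqint mu g \is a fin_num by rewrite ge0_fin_numE// sqint_ge0.
pose G := fine (sqint mu g); have G0 : 0 <= G by rewrite fine_ge0// sqint_ge0.
pose t := e / (2 * (G + 1)).
have G1 : 0 < G + 1 by lra.
have t0 : 0 < t by rewrite divr_gt0// mulr_gt0.
have t1 : 0 < 1 + t^-1 by rewrite addr_gt0// invr_gt0.
have [N NP] := ug (e / (2 * (1 + t^-1))) (divr_gt0 e0 (mulr_gt0 (ltr0Sn _ 1) t1)).
exists N => n Nn.
have md : measurable_fun setT (fun x => g x - u n x) by exact: measurable_funB.
apply: (@le_trans _ _ ((1 + t^-1)%:E * sqint mu (fun x => (g x - u n x)%R) + t%:E * sqint mu g)%E).
  rewrite /sqint -!ge0_integralZl_EFin ?(ltW t0) ?(ltW t1)//;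
    try by [move=> x _; rewrite lee_fin sqr_ge0|exact: measurable_sqr].
  rewrite -ge0_integralD//;
    try by [move=> x _; rewrite -EFinM lee_fin mulr_ge0 ?sqr_ge0 ?(ltW t0) ?(ltW t1)
           |by apply: measurable_funeM; exact: measurable_sqr].
  apply: ge0_le_integral => //.
  - apply/measurable_EFinP; apply: measurableT_comp => //.
    by apply: measurable_funB; exact: measurable_funX.
  - by apply: emeasurable_funD; apply: measurable_funeM; exact: measurable_sqr.
  - move=> x _; rewrite -!EFinM -EFinD lee_fin; move: (g x) (u n x) => p q.
    have h1 : 0 <= t * (p - t^-1 * (p - q)) ^+ 2 by rewrite mulr_ge0 ?sqr_ge0// ltW.
    have h2 : 0 <= t * (p + t^-1 * (p - q)) ^+ 2 by rewrite mulr_ge0 ?sqr_ge0// ltW.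
    have e1 : t * (p - t^-1 * (p - q)) ^+ 2 = t * p ^+ 2 - 2 * p * (p - q) + t^-1 * (p - q) ^+ 2.
      by field; rewrite gt_eqF.
    have e2 : t * (p + t^-1 * (p - q)) ^+ 2 = t * p ^+ 2 + 2 * p * (p - q) + t^-1 * (p - q) ^+ 2.
      by field; rewrite gt_eqF.
    rewrite e1 in h1; rewrite e2 in h2.
    have h3 := sqr_ge0 (p - q).
    rewrite ler_norml mulrDl mul1r; move: (t^-1 * _) (t * _) h1 h2 => A B h1 h2.
    apply/andP; split; nra.
rewrite -(fineK sgf) -/G.
apply: le_trans (leeD (lee_pmul _ _ (lexx _) (NP n Nn)) (lexx _)) _.
- by rewrite lee_fin ltW.
- exact: sqint_ge0.
rewrite -!EFinM -EFinD lee_fin.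
have -> : (1 + t^-1) * (e / (2 * (1 + t^-1))) = e / 2.
  by move: (1 + t^-1) t1 => z z0; field; rewrite gt_eqF.
have : t * G <= e / 2 by rewrite /t mulrAC ler_pdivrMr ?mulr_gt0//; nra.
by lra.
Qed.

End square_convergence.

(** * The embedding of H^1 into L^4 *)

Section L4.
Variable R : realType.
Local Notation V := ((2 * pi) ^+ 2 : R).
Implicit Types (c s : int * int -> R) (k : int * int) (N : nat).

(** Jensen's inequality for the fourth power with weights p and q, from two applications of (a +
    b)^2 <= (p + q) (a^2 / p + b^2 / q). *)
Lemma holder4 (p q u v : R) : 0 < p -> 0 < q ->
  (u + v) ^+ 4 <= (p + q) ^+ 3 * (u ^+ 4 / p ^+ 3 + v ^+ 4 / q ^+ 3).
Proof.
move=> p0 q0.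
have cs a b : (a + b) ^+ 2 <= (p + q) * (a ^+ 2 / p + b ^+ 2 / q).
  have -> : (p + q) * (a ^+ 2 / p + b ^+ 2 / q) = (a + b) ^+ 2 + (p * q) * (a / p - b / q) ^+ 2.
    by field; rewrite !gt_eqF.
  by rewrite lerDl mulr_ge0 ?sqr_ge0// ltW// mulr_gt0.
have h1 := cs u v; have h2 := cs (u ^+ 2 / p) (v ^+ 2 / q).
have -> : (u + v) ^+ 4 = ((u + v) ^+ 2) ^+ 2 by rewrite -exprM.
apply: (@le_trans _ _ (((p + q) * (u ^+ 2 / p + v ^+ 2 / q)) ^+ 2)).
  by rewrite lerXn2r// nnegrE ?sqr_ge0// (le_trans _ h1)// sqr_ge0.
rewrite exprMn [leRHS](_ : _ = (p + q) ^+ 2 * ((p + q) * ((u ^+ 2 / p) ^+ 2 / p + (v ^+ 2 / q) ^+ 2 / q))).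
  by rewrite ler_wpM2l ?sqr_ge0.
by field; rewrite !gt_eqF.
Qed.

Definition nrm2 k : R := k.1%:~R ^+ 2 + k.2%:~R ^+ 2.

Lemma nrm2_ge0 k : 0 <= nrm2 k.
Proof. by rewrite addr_ge0// sqr_ge0. Qed.

Lemma sqr_int_ge (i : int) N : (N < `|i|)%N -> N%:R ^+ 2 <= (i%:~R : R) ^+ 2.
Proof.
move=> Ni; rewrite -[leRHS]real_normK ?num_real// lerXn2r ?nnegrE//.
by rewrite -intr_norm -pmulrn ler_nat ltnW.
Qed.

Lemma nrm2_notin_box k N : k \notin box N -> N%:R ^+ 2 <= nrm2 k.
Proof.
rewrite mem_box negb_and -!ltnNge => /orP[/sqr_int_ge h|/sqr_int_ge h].
- by rewrite (le_trans h)// lerDl sqr_ge0.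
- by rewrite (le_trans h)// lerDr sqr_ge0.
Qed.

Lemma nrm2_ge1 k : k != 0 -> 1 <= nrm2 k.
Proof.
move=> k0; have : k \notin box 0.
  apply: contra k0; rewrite mem_box; case: k => i j /= /andP[hi hj].
  by apply/eqP; congr pair; lia.
rewrite mem_box negb_and -!ltnNge => /orP[h|h].
- have : (1 : R) <= (k.1%:~R : R) ^+ 2.
    rewrite -[leRHS]real_normK ?num_real// -[leLHS](expr1n _ 2) lerXn2r ?nnegrE//.
    by rewrite -intr_norm -pmulrn (ler_nat _ 1).
  by move=> h1; rewrite (le_trans h1)// lerDl sqr_ge0.
- have : (1 : R) <= (k.2%:~R : R) ^+ 2.
    rewrite -[leRHS]real_normK ?num_real// -[leLHS](expr1n _ 2) lerXn2r ?nnegrE//.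
    by rewrite -intr_norm -pmulrn (ler_nat _ 1).
  by move=> h1; rewrite (le_trans h1)// lerDr sqr_ge0.
Qed.

Definition dirichlet c s N : R := \sum_(k <- box N) nrm2 k * (c k ^+ 2 + s k ^+ 2).

Lemma norm_trig_le c s N (x : plane R) : `|trig c s N x| <= \sum_(k <- box N) (`|c k| + `|s k|).
Proof.
apply: le_trans (ler_norm_sum _ _ _) _; apply: ler_sum => k _.
apply: le_trans (ler_normD _ _) _; rewrite !normrM.
by apply: lerD; rewrite ler_piMr ?cos_max ?sin_max.
Qed.

(* AM-GM: |c| <= (|k|^2 c^2 + |k|^-2) / 2, and |k|^-2 <= e. *)
Lemma trig_sup c s N (e : R) (x : plane R) : 0 < e ->
  (forall k, (c k = 0 /\ s k = 0) \/ 1 <= e * nrm2 k) ->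
  `|trig c s N x| <= dirichlet c s N / 2 + e * (size (box N))%:R.
Proof.
move=> e0 ek; apply: le_trans (norm_trig_le _ _ _ _) _.
rewrite /dirichlet mulr_suml -[X in e * X](_ : \sum_(k <- box N) 1 = _); last first.
  by rewrite big_const_seq count_predT iter_addr_0.
rewrite mulr_sumr -big_split /=; apply: ler_sum => k _.
rewrite mulr1; case: (ek k) => [[-> ->]|ek1].
  by rewrite normr0 expr0n /= !addr0 mulr0 mul0r add0r ltW.
rewrite -(real_normK (num_real (c k))) -(real_normK (num_real (s k))).
have := normr_ge0 (c k); have := normr_ge0 (s k).
move: (nrm2 k) ek1 `|c k| `|s k| => w ek1 a b b0 a0.
have w0 : 0 < w by rewrite -(pmulr_rgt0 _ e0); lra.
have P a' : a' <= (w * a' ^+ 2 + e) / 2.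
  rewrite ler_pdivlMr// -subr_ge0.
  rewrite -(pmulr_rge0 _ w0).
  have := sqr_ge0 (w * a' - 1); nra.
by have := P a; have := P b; lra.
Qed.

Lemma bmfunX (h : plane R -> R) n : bmfun h -> bmfun (fun x => h x ^+ n).
Proof.
move=> bh; elim: n => [|n IH]; first exact: bmfun_cst.
by under eq_fun do rewrite exprS; exact: bmfunM.
Qed.

Lemma le_Rintegral_bmfun (g h : plane R -> R) : bmfun g -> bmfun h ->
  (forall x, g x <= h x) -> \int[torus R]_x g x <= \int[torus R]_x h x.
Proof. by move=> bg bh gh; apply: le_Rintegral => //; exact: bmfun_integrable. Qed.

(* On the block 4^j < |k| <= 4^j.+1 the sup norm is bounded while the squared L^2
   norm is at most V B 16^-j. *)
Lemma Rintegral_block c s (B : R) j : hermitian_coef c s ->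
  (forall N, dirichlet c s N <= B) ->
  \int[torus R]_x (trig c s (4 ^ j.+1) x - trig c s (4 ^ j) x) ^+ 4 <=
  ((B / 2 + 81) ^+ 2 * (V * B)) * (16^-1) ^+ j.
Proof.
move=> cs DB; set N := (4 ^ j)%N; set M := (4 ^ j.+1)%N.
have NM : (N <= M)%N by rewrite leq_exp2l.
have N0 : 0 < N%:R :> R by rewrite ltr0n expn_gt0.
pose c' k := (k \notin box N)%:R * c k; pose s' k := (k \notin box N)%:R * s k.
have cs' : hermitian_coef c' s' := hermitian_mask N cs.
have -> : (fun x => (trig c s M x - trig c s N x) ^+ 4) = fun x => trig c' s' M x ^+ 2 * trig c' s' M x ^+ 2.
  by apply/funext => x; rewrite trigB// -exprD.
have D'B : dirichlet c' s' M <= B.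
  apply: le_trans (DB M); apply: ler_sum => k _; rewrite ler_wpM2l ?nrm2_ge0//.
  by rewrite /c' /s'; case: (k \notin box N); rewrite ?mul1r// !mul0r expr0n addr0 addr_ge0 ?sqr_ge0.
have D'0 : 0 <= dirichlet c' s' M.
  by apply: sumr_ge0 => k _; rewrite mulr_ge0 ?nrm2_ge0// addr_ge0 ?sqr_ge0.
(* Outside [box N] one has |k|^2 >= N^2, so e = N^-2 is admissible in [trig_sup]; [box M] has (8 N +
   1)^2 <= 81 N^2 points, whence 81. *)
have sup x : `|trig c' s' M x| <= B / 2 + 81.
  have e0 : 0 < (N%:R ^+ 2)^-1 :> R by rewrite invr_gt0 exprn_gt0.
  apply: le_trans (trig_sup M x e0 _) _.
    move=> k; rewrite /c' /s'; case: (boolP (k \in box N)) => kN; [left|right].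
      by rewrite !mul0r.
    by rewrite mulrC ler_pdivlMr ?exprn_gt0// mul1r nrm2_notin_box.
  apply: lerD; first by lra.
  rewrite size_box mulrC ler_pdivrMr ?exprn_gt0//.
  have : (M.*2.+1)%:R <= 9 * N%:R :> R.
    rewrite -natrM ler_nat /M expnS -/N.
    have : (0 < N)%N by rewrite expn_gt0.
    lia.
  rewrite natrM => h.
  apply: (@le_trans _ _ ((9 * N%:R) * (9 * N%:R))); first exact: ler_pM.
  by rewrite expr2; lra.
have bt := bmfun_trig c' s' M.
apply: (@le_trans _ _ (\int[torus R]_x ((B / 2 + 81) ^+ 2 * trig c' s' M x ^+ 2))).
  apply: le_Rintegral_bmfun.
  - by apply: bmfunM; exact: bmfunX.
  - by apply: (bmfunM (bmfun_cst _)); exact: bmfunX.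
  - move=> x; rewrite ler_wpM2r ?sqr_ge0// -(real_normK (num_real (trig _ _ _ _))).
    by rewrite lerXn2r// nnegrE (le_trans _ (sup x)).
rewrite Rintegral_bmfunZ; last exact: bmfunX.
rewrite Parseval// -[leRHS]mulrA ler_wpM2l ?sqr_ge0// -[leRHS]mulrA ler_wpM2l ?(ltW (V_gt0 R))//.
have -> : (16^-1 : R) ^+ j = (N%:R ^+ 2)^-1.
  by rewrite -natrX /N -expnM mulnC expnM natrX exprVn.
rewrite ler_pdivlMr ?exprn_gt0//; apply: le_trans D'B.
rewrite mulr_suml; apply: ler_sum => k _; rewrite mulrC.
rewrite /c' /s'; case: (boolP (k \in box N)) => kN /=.
  by rewrite !mul0r expr0n addr0 !mulr0.
by rewrite ler_wpM2r ?addr_ge0 ?sqr_ge0// nrm2_notin_box.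
Qed.

(** The block estimates are summed by induction on j. Vanishing at k = 0 lets the Dirichlet energy
    control the lowest frequencies, and the final factor 2^4 comes from weights bounded by 2. *)
Lemma trig_L4 (B : R) : exists C : R, forall c s, hermitian_coef c s ->
  c 0 = 0 -> s 0 = 0 -> (forall N, dirichlet c s N <= B) ->
  forall j, \int[torus R]_x (trig c s (4 ^ j) x) ^+ 4 <= C.
Proof.
pose K := (B / 2 + 81) ^+ 2 * (V * B).
(* The first term starts the induction, [box 1] having 9 points. The second absorbs each new block:
   with q = 2^-(j+1) one has q^-3 16^-j = 16 q. *)
pose A := (B / 2 + 9) ^+ 4 * V + 16 * K.
exists (A * 2 ^+ 4) => c s cs c0 s0 DB.
have B0 : 0 <= B.
  apply: le_trans (DB 0%N).
  by apply: sumr_ge0 => k _; rewrite mulr_ge0 ?nrm2_ge0// addr_ge0 ?sqr_ge0.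
have V0 := V_gt0 R.
have K0 : 0 <= K by rewrite mulr_ge0 ?sqr_ge0// mulr_ge0// ltW.
have A9 : 0 <= (B / 2 + 9) ^+ 4 * V.
  by apply: mulr_ge0; [apply: exprn_ge0; lra|exact: ltW].
have A0 : 0 <= A by rewrite addr_ge0// mulr_ge0.
have K16 : 16 * K <= A by rewrite lerDr.
(* With the weights w j and 2^-j.+1, which sum to w j.+1, holder4 plays the role of
   Minkowski's inequality in the sum of the dyadic blocks. *)
pose w j : R := 2 - (2^-1) ^+ j.
have w1 j : 1 <= w j.
  have : (2^-1 : R) ^+ j <= 1 by rewrite exprn_ile1//; lra.
  by rewrite /w; lra.
have w2 j : w j <= 2.
  have : 0 <= (2^-1 : R) ^+ j by rewrite exprn_ge0//; lra.
  by rewrite /w; lra.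
suff IH j : \int[torus R]_x (trig c s (4 ^ j) x) ^+ 4 <= A * w j ^+ 4.
  move=> j; apply: le_trans (IH j) _; rewrite ler_wpM2l// lerXn2r ?nnegrE//.
  by rewrite (le_trans _ (w1 j)).
elim: j => [|j IH].
  rewrite /w expr0 (_ : 2 - 1 = 1 :> R) ?expr1n ?mulr1; last by lra.
  apply: (@le_trans _ _ ((B / 2 + 9) ^+ 4 * V)); last by rewrite lerDl mulr_ge0.
  have -> : (B / 2 + 9) ^+ 4 * V = \int[torus R]_x ((B / 2 + 9) ^+ 4).
    by rewrite Rintegral_cst// torus_setT.
  apply: le_Rintegral_bmfun; [exact/bmfunX/bmfun_trig|exact: bmfun_cst|move=> x].
  have h : `|trig c s 1 x| <= B / 2 + 9.
    apply: le_trans (trig_sup 1 x ltr01 _) _.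
      move=> k; have [->|k0] := eqVneq k 0; [by left|right].
      by rewrite mul1r nrm2_ge1.
    by rewrite size_box mul1r lerD2r; have := DB 1%N; lra.
  rewrite -[leLHS]ger0_norm; last by rewrite (_ : 4 = 2 * 2)%N// exprM sqr_ge0.
  by rewrite normrX lerXn2r ?nnegrE// (le_trans _ h).
pose q : R := (2^-1) ^+ j.+1.
have q0 : 0 < q by rewrite exprn_gt0// invr_gt0.
have wp : 0 < w j by rewrite (lt_le_trans ltr01).
have wS : w j.+1 = w j + q by rewrite /w /q exprS; lra.
have bt i := bmfun_trig c s (4 ^ i).
have bD : bmfun (fun x => trig c s (4 ^ j.+1) x - trig c s (4 ^ j) x).
  have := bmfunD (bt j.+1) (bmfunM (bmfun_cst (-1)) (bt j)).
  by under eq_fun do rewrite mulN1r.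
pose h x := (w j + q) ^+ 3 * ((w j ^- 3) * (trig c s (4 ^ j) x) ^+ 4 +
  (q ^- 3) * (trig c s (4 ^ j.+1) x - trig c s (4 ^ j) x) ^+ 4).
have bu : bmfun (fun x => w j ^- 3 * (trig c s (4 ^ j) x) ^+ 4).
  by apply: (bmfunM (bmfun_cst _)); exact: bmfunX.
have bv : bmfun (fun x => q ^- 3 * (trig c s (4 ^ j.+1) x - trig c s (4 ^ j) x) ^+ 4).
  by apply: (bmfunM (bmfun_cst _)); exact: bmfunX.
apply: (@le_trans _ _ (\int[torus R]_x h x)).
  apply: le_Rintegral_bmfun; first exact: bmfunX.
    by apply: (bmfunM (bmfun_cst _)); exact: bmfunD.
  move=> x; rewrite /h -[X in X ^+ 4 <= _](subrK (trig c s (4 ^ j) x)) addrC.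
  by have := holder4 (trig c s (4 ^ j) x) (trig c s (4 ^ j.+1) x - trig c s (4 ^ j) x) wp q0;
    rewrite ![_ ^+ 4 / _]mulrC.
rewrite /h Rintegral_bmfunZ; last exact: bmfunD.
rewrite Rintegral_bmfunD// !Rintegral_bmfunZ; [|exact: bmfunX..].
rewrite wS exprSr mulrCA -wS; rewrite mulrC -mulrA.
have w30 : 0 <= w j.+1 ^+ 3 by rewrite exprn_ge0// (le_trans _ (w1 _)).
rewrite [leRHS](_ : _ = w j.+1 ^+ 3 * (A * w j.+1)); last by ring.
rewrite [leLHS]mulrC ler_wpM2l//.
have blk := Rintegral_block j cs DB; rewrite -/K in blk.
have -> : A * w j.+1 = w j ^- 3 * (A * w j ^+ 4) + A * q.
  by rewrite wS; field; rewrite gt_eqF.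
apply: lerD; first by rewrite ler_wpM2l// invr_ge0 exprn_ge0// ltW.
apply: (@le_trans _ _ (q ^- 3 * (K * 16^-1 ^+ j))).
  by rewrite ler_wpM2l// invr_ge0 exprn_ge0// ltW.
have -> : (16^-1 : R) ^+ j = 16 * q ^+ 4.
  rewrite /q -exprM mulnC exprM exprS (_ : (2^-1 : R) ^+ 4 = 16^-1).
    by rewrite mulrA mulfV ?mul1r.
  by rewrite exprVn -natrX.
have -> : q ^- 3 * (K * (16 * q ^+ 4)) = 16 * K * q by field; rewrite gt_eqF.
by rewrite ler_wpM2r// ltW.
Qed.

End L4.

(** * Measurability of the norms *)

(* The measure torus R carries no canonical instance of finite measure, which
   Tonelli's theorem requires. *)
Section finite_measure_of.
Variables (d : measure_display) (T : measurableType d) (R : realType).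
Variables (m : {measure set T -> \bar R}) (m_fin : fin_num_fun m).

Let m' : set T -> \bar R := m.
HB.instance Definition _ := Measure.on m'.
HB.instance Definition _ := Measure_isFinite.Build _ _ _ m' m_fin.

Definition finite_measure_of : {finite_measure set T -> \bar R} := m'.

End finite_measure_of.

Section phase_space_measurability.
Variable R : realType.
Local Notation V := ((2 * pi) ^+ 2 : R).
Local Notation sq := (@sqint _ _ R (torus R)).
Local Notation mu := (@lebesgue_measure R).
Local Notation leb2 := (mu \x mu)%E.
Implicit Types (c s a b : int * int -> R) (k : int * int) (N M : nat).

(** Strict superlevel sets are open in the sense of [openL2], and open half-lines generate the Borel
    sets of the reals. *)
Lemma continuous_measurable_L2 (phi : L2 R -> R) :
  (forall f : L2 R, forall r : R, 0 < r -> exists2 h : R, 0 < h &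
     forall g : L2 R, (normL 2 (fsub g f) < h%:E)%E -> `|phi g - phi f| < r) ->
  measurable_fun setT (phi : borelL2 R -> R).
Proof.
move=> cphi mT; apply: (measurability _ (RGenOInfty.measurableE R)) => //.
move=> _ [_ [x ->] <-]; rewrite setTI; apply: sub_sigma_algebra => f /=.
rewrite in_itv/= andbT => xf.
rewrite -subr_gt0 in xf; have [h h0 hP] := cphi f _ xf.
exists h => // g /hP; rewrite ltr_distl in_itv/= andbT => /andP[+ _].
by rewrite opprB addrC subrK.
Qed.

Lemma measurable_dot (phi : plane R -> R) : bmfun phi -> (forall x, `|phi x| <= 1) ->
  measurable_fun setT (fun f : borelL2 R => dot (f : L2 R) phi).
Proof.
move=> bphi phi1; apply: (continuous_measurable_L2 (phi := fun f => dot f phi)).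
move=> f r r0; have [e e0 eP] := dot_small bphi phi1 r0.
exists (Num.sqrt e); first by rewrite sqrtr_gt0.
move=> g /normL2_lt; rewrite sqrtr_gt0 => /(_ e0); rewrite sqr_sqrtr ?(ltW e0)// => /ltW.
rewrite -dotBl//; try exact: in_L2_L2.
by apply: eP; apply: in_L2B; exact: in_L2_L2.
Qed.

Lemma measurable_cos_coef k : measurable_fun setT (fun f : borelL2 R => cos_coef (f : L2 R) k).
Proof.
apply: measurable_funM => //; apply: measurable_dot; first exact: bmfun_cos.
by move=> x; exact: cos_max.
Qed.

Lemma measurable_sin_coef k : measurable_fun setT (fun f : borelL2 R => sin_coef (f : L2 R) k).
Proof.
apply: measurable_funM => //; apply: measurable_dot; first exact: bmfun_sin.
by move=> x; exact: sin_max.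
Qed.

Lemma measurable_mult_cos a b k :
  measurable_fun setT (fun f : borelL2 R => mult_cos a b (f : L2 R) k).
Proof.
by apply: measurable_funD; apply: measurable_funM => //;
  [exact: measurable_cos_coef|exact: measurable_sin_coef].
Qed.

Lemma measurable_mult_sin a b k :
  measurable_fun setT (fun f : borelL2 R => mult_sin a b (f : L2 R) k).
Proof.
by apply: measurable_funB; apply: measurable_funM => //;
  [exact: measurable_sin_coef|exact: measurable_cos_coef].
Qed.

Lemma measurable_wsup w : measurable_fun setT (fun f : borelL2 R => wsup w (f : L2 R)).
Proof.
apply: (emeasurable_fun_sup (f := fun N (f : borelL2 R) => (V * wenergy w (f : L2 R) N)%:E)).
move=> N; apply/measurable_EFinP; apply: measurable_funM => //.
apply: measurable_sum => k; apply: measurable_funM => //.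
apply: measurable_funD; apply: measurable_funX.
- exact: measurable_cos_coef.
- exact: measurable_sin_coef.
Qed.

Lemma expe_lty (x : \bar R) n : (0 <= x)%E -> (x ^+ n.+1 < +oo)%E = (x < +oo)%E.
Proof.
case: x => [x| |] //; first by rewrite -EFin_expe !ltry.
move=> _; rewrite [in RHS]ltxx; apply/negbTE; rewrite -leNgt leye_eq; apply/eqP.
by elim: n => [//|n IH]; rewrite expeS IH.
Qed.

Lemma spaceHE (s : R) (f : L2 R) :
  spaceH s f <-> (wsup (lap_weight s) f < +oo)%E.
Proof. by rewrite /spaceH /= -normH_sqr expe_lty// normH_ge0. Qed.

Lemma measurable_spaceH (s : R) : measurable (spaceH s : set (borelL2 R)).
Proof.
have -> : (spaceH s : set (borelL2 R)) =
    setT `&` [set f | wsup (lap_weight s) (f : L2 R) < +oo]%E.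
  by apply/seteqP; split => [f /spaceHE|f [_ /= /spaceHE]].
by apply: emeasurable_fun_infty_o => //; exact: measurable_wsup.
Qed.

(** * The gradient and its L^4 norm as functions of the Fourier coefficients *)

Definition dx_sym : int * int -> R := fun k => k.1%:~R.
Definition dy_sym : int * int -> R := fun k => k.2%:~R.

Lemma dx_sym_odd k : dx_sym (- k) = - dx_sym k.
Proof. exact: mulrNz. Qed.
Lemma dy_sym_odd k : dy_sym (- k) = - dy_sym k.
Proof. exact: mulrNz. Qed.

Definition dx_weight k : R := (cst 0 : int * int -> R) k ^+ 2 + dx_sym k ^+ 2.
Definition dy_weight k : R := (cst 0 : int * int -> R) k ^+ 2 + dy_sym k ^+ 2.

Definition dx_sum (f : plane R -> R) N :=
  trig (mult_cos (cst 0) dx_sym f) (mult_sin (cst 0) dx_sym f) N.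
Definition dy_sum (f : plane R -> R) N :=
  trig (mult_cos (cst 0) dy_sym f) (mult_sin (cst 0) dy_sym f) N.

Definition gradient_exists (f : plane R -> R) :=
  (exists g, is_dx f g) /\ (exists g, is_dy f g).

Lemma gradient_existsE (f : plane R -> R) : gradient_exists f <->
  (wsup dx_weight f < +oo)%E /\
  (wsup dy_weight f < +oo)%E.
Proof.
have ex := exists_multiplierE (a := cst 0) f (fun=> erefl) dx_sym_odd.
have ey := exists_multiplierE (a := cst 0) f (fun=> erefl) dy_sym_odd.
by split=> -[/ex hx /ey hy].
Qed.

Lemma in_L2_measurable (h : plane R -> R) : in_L2 h -> measurable_fun setT h.
Proof. by move=> /in_L2P[]. Qed.

Lemma sqr_multiplier_cvg a b (f : plane R -> R) :
  (forall k, a (- k) = a k) -> (forall k, b (- k) = - b k) ->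
  (exists g, is_multiplier a b f g) ->
  forall e : R, 0 < e -> exists N, forall n, (N <= n)%N ->
    (\int[torus R]_x (`|multiplier a b f x ^+ 2 -
       trig (mult_cos a b f) (mult_sin a b f) n x ^+ 2|)%:E <= e%:E)%E.
Proof.
move=> ae bo ex; have /is_multiplierP[/in_L2P[mg sg] gP] := multiplierP ex.
by apply: sqr_cvg_L1 => // n; exact: measurable_trig.
Qed.

Definition grad_sqr_sum (f : plane R -> R) N (x : plane R) : R :=
  dx_sum f N x ^+ 2 + dy_sum f N x ^+ 2.

Lemma bmfun_grad_sqr_sum f N : bmfun (grad_sqr_sum f N).
Proof. by apply: bmfunD; apply: bmfunX; exact: bmfun_trig. Qed.

Lemma grad_sqr_sum_ge0 f N x : 0 <= grad_sqr_sum f N x.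
Proof. by rewrite addr_ge0// sqr_ge0. Qed.

(** The fourth power of the L^4 norm of the gradient, written through Fourier partial sums so that
    it makes sense for every f and is measurable in f; it agrees with the norm on
    [gradient_exists]. *)
Definition grad4 (f : plane R -> R) : \bar R :=
  ereal_sup (range (fun M => limn_esup (fun N => trunc_sqint (torus R) (grad_sqr_sum f N) M))).

Lemma grad_dotff (f : plane R -> R) : grad_dot f f = fun x => dx f x ^+ 2 + dy f x ^+ 2.
Proof. by apply/funext => x; rewrite /grad_dot !expr2. Qed.

Lemma gradient_L2 f : gradient_exists f -> in_L2 (dx f) /\ in_L2 (dy f).
Proof.
by move=> [hx hy]; split;
  [have /is_multiplierP[] := multiplierP hx|have /is_multiplierP[] := multiplierP hy].
Qed.

(* The truncation makes the integrand Lipschitz in |grad f|^2, so that it passes to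
   the limit along the Fourier partial sums without any bound on their L^4 norms. *)
Lemma sqint_grad_dot f : gradient_exists f -> sq (grad_dot f f) = grad4 f.
Proof.
move=> fD; have [/in_L2_measurable mx /in_L2_measurable my] := gradient_L2 fD.
rewrite grad_dotff; have [hx hy] := fD.
have mg : measurable_fun setT (fun x => dx f x ^+ 2 + dy f x ^+ 2).
  by apply: measurable_funD; exact: measurable_funX.
rewrite -trunc_sqint_sup//; last by move=> x; rewrite addr_ge0// sqr_ge0.
rewrite /grad4; suff -> : trunc_sqint (torus R) (fun x => dx f x ^+ 2 + dy f x ^+ 2) =
  (fun M => limn_esup (fun N => trunc_sqint (torus R) (grad_sqr_sum f N) M)) by [].
apply/funext => M.
have /cvg_limn_einf_sup[_ ->//] : trunc_sqint (torus R) (grad_sqr_sum f N) M @[N --> \oo] -->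
  trunc_sqint (torus R) (fun x => dx f x ^+ 2 + dy f x ^+ 2) M.
apply: trunc_sqint_cvg => //.
- exact: torus_fin.
- by move=> n; exact: (bmfun_grad_sqr_sum f n).1.
- by move=> n x; exact: grad_sqr_sum_ge0.
- by move=> x; rewrite addr_ge0// sqr_ge0.
- move=> e e0.
  have [N1 P1] := sqr_multiplier_cvg (a := cst 0) (fun=> erefl) dx_sym_odd hx (divr_gt0 e0 (ltr0Sn _ 1)).
  have [N2 P2] := sqr_multiplier_cvg (a := cst 0) (fun=> erefl) dy_sym_odd hy (divr_gt0 e0 (ltr0Sn _ 1)).
  exists (maxn N1 N2) => n; rewrite geq_max => /andP[n1 n2].
  have m1 : measurable_fun setT (fun x => (`|dx f x ^+ 2 - dx_sum f n x ^+ 2|)%:E).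
    apply/measurable_EFinP; apply: measurableT_comp => //; apply: measurable_funB; apply: measurable_funX => //.
    exact: measurable_trig.
  have m2 : measurable_fun setT (fun x => (`|dy f x ^+ 2 - dy_sum f n x ^+ 2|)%:E).
    apply/measurable_EFinP; apply: measurableT_comp => //; apply: measurable_funB; apply: measurable_funX => //.
    exact: measurable_trig.
  rewrite [e](splitr e) EFinD; apply: le_trans (leeD (P1 n n1) (P2 n n2)).
  rewrite -ge0_integralD//.
  apply: ge0_le_integral => //.
  + apply/measurable_EFinP; apply: measurableT_comp => //; apply: measurable_funB => //.
    exact: (bmfun_grad_sqr_sum f n).1.
  + exact: emeasurable_funD.
  + move=> x _; rewrite -EFinD lee_fin /grad_sqr_sum opprD addrACA; exact: ler_normD.
Qed.

Lemma normL4_sqr (h : plane R -> R) : (forall x, 0 <= h x) ->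
  (normL 4 (fun x => Num.sqrt (h x)) ^+ 4 = sq h)%E.
Proof.
move=> h0.
have pE (x : \bar R) : (0 <= x)%E -> (x ^+ 4 = x `^ 4)%E.
  case: x => [x| |] //; first by rewrite lee_fin => x0; rewrite poweR_EFin powR_mulrn// EFin_expe.
  by move=> _; rewrite poweRyr.
rewrite pE ?Lnorm_ge0// /normL poweR_Lnorm//; apply: eq_integral => x _.
rewrite /= powR_mulrn// -normrX (_ : 4 = 2 * 2)%N// exprM sqr_sqrtr//.
by rewrite ger0_norm// sqr_ge0.
Qed.

Lemma normW14_ge0 (f : plane R -> R) : (0 <= normW14 f)%E.
Proof. by rewrite /normW14; case: asboolP => // _; exact: Lnorm_ge0. Qed.

Lemma normW14_4 f : gradient_exists f -> (normW14 f ^+ 4 = grad4 f)%E.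
Proof.
move=> fD; rewrite /normW14; case: asboolP => [_|/(_ fD)//].
rewrite normL4_sqr; last by move=> x; rewrite grad_dotff addr_ge0// sqr_ge0.
exact: sqint_grad_dot.
Qed.

Lemma torus_fin_num : fin_num_fun (torus R).
Proof.
move=> A mA; rewrite ge0_fin_numE ?measure_ge0//.
by apply: le_lt_trans (@torus_fin R); apply: le_measure => //; rewrite inE.
Qed.

(** The truncated integrand is jointly measurable in (f, x), being built from Fourier coefficients
    of f and trigonometric functions of x, so Tonelli's theorem makes its integral over x measurable
    in f. *)
Lemma measurable_grad4 : measurable_fun setT (fun f : borelL2 R => grad4 (f : L2 R)).
Proof.
apply: (emeasurable_fun_sup (f := fun M (f : borelL2 R) =>
  limn_esup (fun N => trunc_sqint (torus R) (grad_sqr_sum (f : L2 R) N) M))) => M.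
apply: measurable_fun_limn_esup => N.
pose H (p : borelL2 R * plane R) : \bar R :=
  ((Num.min (grad_sqr_sum (p.1 : L2 R) N p.2) M%:R) ^+ 2)%:E.
have mH : measurable_fun setT H.
  have mtrig (c s : L2 R -> int * int -> R) :
      (forall k, measurable_fun setT (fun f : borelL2 R => c f k)) ->
      (forall k, measurable_fun setT (fun f : borelL2 R => s f k)) ->
      measurable_fun setT (fun p : borelL2 R * plane R => trig (c p.1) (s p.1) N p.2).
    move=> mc ms; apply: measurable_sum => k; apply: measurable_funD; apply: measurable_funM.
    - exact: (measurableT_comp (mc k) measurable_fst).
    - exact: (measurableT_comp (@bmfun_cos R k).1 measurable_snd).
    - exact: (measurableT_comp (ms k) measurable_fst).
    - exact: (measurableT_comp (@bmfun_sin R k).1 measurable_snd).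
  apply/measurable_EFinP; apply: measurable_funX; apply: measurable_minr => //.
  have mt b := mtrig (fun f => mult_cos (cst 0) b f) (fun f => mult_sin (cst 0) b f)
      (measurable_mult_cos (cst 0) b) (measurable_mult_sin (cst 0) b).
  by apply: measurable_funD; apply: measurable_funX; exact: mt.
have H0 p : (0 <= H p)%E by rewrite lee_fin sqr_ge0.
exact: (@measurable_fun_fubini_tonelli_F _ _ _ _ R (finite_measure_of torus_fin_num) H mH H0).
Qed.

(** [grad4] is known to represent the norm only when both derivatives exist, so this condition
    enters as the first two of the five sets. *)
Lemma measurable_S_set (K : R) : measurable (S_set K : set (borelL2 R)).
Proof.
pose w := lap_weight (3 / 2 : R).
pose A1 := setT `&` [set f : borelL2 R | (wsup dx_weight (f : L2 R) < +oo)%E].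
pose A2 := setT `&` [set f : borelL2 R | (wsup dy_weight (f : L2 R) < +oo)%E].
pose A3 := setT `&` [set f : borelL2 R | (grad4 (f : L2 R) < +oo)%E].
pose A4 := setT `&` [set f : borelL2 R | (wsup w (f : L2 R) < +oo)%E].
pose A5 := setT `&` [set f : borelL2 R | (K%:E <= grad4 (f : L2 R) + wsup w (f : L2 R))%E].
have -> : (S_set K : set (borelL2 R)) = A1 `&` A2 `&` A3 `&` A4 `&` A5.
  apply/seteqP; split => f.
    move=> [W H KWH].
    have fD : gradient_exists (f : L2 R) by move: W; rewrite /normW14; case: asboolP.
    have /gradient_existsE[fx fy] := fD.
    rewrite normW14_4 ?normH_sqr// in KWH.
    do ![split => //].
    - by rewrite /= -normW14_4// expe_lty// normW14_ge0.
    - by rewrite /= -(normH_sqr (3 / 2)) expe_lty// normH_ge0.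
  move=> [[[[[_ fx] [_ fy]] [_ W]] [_ H]] [_ KWH]].
  have fD : gradient_exists (f : L2 R) by apply/gradient_existsE.
  split.
  - by rewrite -(@expe_lty _ 3) ?normW14_ge0// normW14_4.
  - by rewrite -(@expe_lty _ 1) ?normH_ge0// normH_sqr.
  - by rewrite normW14_4// normH_sqr.
have mw v := @emeasurable_fun_infty_o _ _ _ _ _ measurableT (measurable_wsup v) +oo%E.
have mg := measurable_grad4.
have mA3 : measurable A3 by exact: emeasurable_fun_infty_o.
have mA5 : measurable A5.
  apply: emeasurable_fun_c_infty => //.
  by apply: emeasurable_funD => //; exact: measurable_wsup.
apply: measurableI => //; apply: measurableI; last exact: mw.
by apply: measurableI => //; apply: measurableI; exact: mw.
Qed.

End phase_space_measurability.

(** * The balance relation *)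

(** To be used with p the gradient of f and q that of (-Delta)^(-1/2) f: by Cauchy-Schwarz and Young
    the integrand is at most |p|^4 + 2 q1^4 + 2 q2^4 in absolute value. *)
Lemma Rintegral_quartic_le d (T : measurableType d) (R : realType)
    (mu : {measure set T -> \bar R}) (p1 p2 q1 q2 : T -> R) (A C : R) :
  measurable_fun setT p1 -> measurable_fun setT p2 ->
  measurable_fun setT q1 -> measurable_fun setT q2 ->
  (sqint mu (fun x => p1 x * p1 x + p2 x * p2 x)%R <= A%:E)%E ->
  (sqint mu (fun x => q1 x ^+ 2)%R <= C%:E)%E ->
  (sqint mu (fun x => q2 x ^+ 2)%R <= C%:E)%E ->
  `|\int[mu]_x ((p1 x * p1 x + p2 x * p2 x) * (p1 x * q1 x + p2 x * q2 x))| <=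
  `|A| + 4 * `|C|.
Proof.
move=> m1 m2 n1 n2; set P := fun x => p1 x * p1 x + p2 x * p2 x => PA q1C q2C.
pose h x := P x * (p1 x * q1 x + p2 x * q2 x).
have mP : measurable_fun setT P by apply: measurable_funD; exact: measurable_funM.
have mh : measurable_fun setT h.
  by apply: measurable_funM => //; apply: measurable_funD; exact: measurable_funM.
have mP2 := measurable_sqr mP.
have mq1 := measurable_sqr (measurable_funX 2 n1).
have mq2 := measurable_sqr (measurable_funX 2 n2).
have sq0 (u : T -> R) x : (0 <= ((u x) ^+ 2)%:E)%E by rewrite lee_fin sqr_ge0.
have sq20 (u : T -> R) x : (0 <= 2%:E * ((u x) ^+ 2)%:E)%E.
  by rewrite -EFinM lee_fin mulr_ge0// sqr_ge0.
have hle : (\int[mu]_x (`|h x|)%:E <= (`|A| + 4 * `|C|)%:E)%E.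
  apply: (@le_trans _ _ (sqint mu P + (2%:E * sqint mu (fun x => q1 x ^+ 2)%R +
      2%:E * sqint mu (fun x => q2 x ^+ 2)%R))%E); last first.
    have CC : C <= `|C| by exact: ler_norm.
    rewrite [leRHS]EFinD; apply: leeD; first by rewrite (le_trans PA)// lee_fin ler_norm.
    rewrite (_ : 4 * `|C| = 2 * `|C| + 2 * `|C|); last by ring.
    rewrite [leRHS]EFinD !EFinM; apply: leeD; apply: lee_pmul; rewrite ?lee_fin ?sqint_ge0//.
    - by rewrite (le_trans q1C)// lee_fin.
    - by rewrite (le_trans q2C)// lee_fin.
  have E1 : (2%:E * sqint mu (fun x => q1 x ^+ 2)%R = \int[mu]_x (2%:E * ((q1 x ^+ 2) ^+ 2)%:E))%E.
    by rewrite ge0_integralZl_EFin// => x _; exact: sq0 (fun x => q1 x ^+ 2) x.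
  have E2 : (2%:E * sqint mu (fun x => q2 x ^+ 2)%R = \int[mu]_x (2%:E * ((q2 x ^+ 2) ^+ 2)%:E))%E.
    by rewrite ge0_integralZl_EFin// => x _; exact: sq0 (fun x => q2 x ^+ 2) x.
  have M1 : measurable_fun setT (fun x => 2%:E * ((q1 x ^+ 2) ^+ 2)%:E)%E by exact: measurable_funeM.
  have M2 : measurable_fun setT (fun x => 2%:E * ((q2 x ^+ 2) ^+ 2)%:E)%E by exact: measurable_funeM.
  have M12 : measurable_fun setT (fun x => 2%:E * ((q1 x ^+ 2) ^+ 2)%:E + 2%:E * ((q2 x ^+ 2) ^+ 2)%:E)%E.
    exact: emeasurable_funD.
  have S1 x : (0 <= 2%:E * ((q1 x ^+ 2) ^+ 2)%:E)%E by exact: sq20 (fun x => q1 x ^+ 2) x.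
  have S2 x : (0 <= 2%:E * ((q2 x ^+ 2) ^+ 2)%:E)%E by exact: sq20 (fun x => q2 x ^+ 2) x.
  rewrite E1 E2 -(ge0_integralD mu measurableT (fun x _ => S1 x) M1 (fun x _ => S2 x) M2).
  rewrite /sqint -(ge0_integralD mu measurableT (fun x _ => sq0 P x) mP2
    (fun x _ => adde_ge0 (S1 x) (S2 x)) M12).
  apply: ge0_le_integral => //.
  - by apply/measurable_EFinP; exact: measurableT_comp.
  - exact: emeasurable_funD.
  - move=> x _; rewrite -!EFinM -!EFinD lee_fin /h /P.
    move: (p1 x) (p2 x) (q1 x) (q2 x) => a1 a2 b1 b2.
    have cs : `|a1 * b1 + a2 * b2| <= ((a1 ^+ 2 + a2 ^+ 2) + (b1 ^+ 2 + b2 ^+ 2)) / 2.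
      rewrite ler_norml; have := sqr_ge0 (a1 - b1); have := sqr_ge0 (a2 - b2).
      have := sqr_ge0 (a1 + b1); have := sqr_ge0 (a2 + b2) => *; apply/andP; split; nra.
    rewrite normrM -!expr2 ger0_norm ?addr_ge0 ?sqr_ge0//.
    have P0 : 0 <= a1 ^+ 2 + a2 ^+ 2 by rewrite addr_ge0 ?sqr_ge0.
    apply: le_trans (ler_wpM2l P0 cs) _.
    move: (a1 ^+ 2 + a2 ^+ 2) P0 (b1 ^+ 2) (sqr_ge0 b1) (b2 ^+ 2) (sqr_ge0 b2) => c c0 x1 x10 x2 x20.
    have := sqr_ge0 (c - (x1 + x2)); have := sqr_ge0 (x1 - x2); nra.
have ih : mu.-integrable setT (EFin \o h).
  apply/integrableP; split; first exact/measurable_EFinP.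
  by apply: le_lt_trans hle _; exact: ltry.
apply: le_trans (le_normr_Rintegral measurableT ih) _.
rewrite -lee_fin /Rintegral fineK//; apply: (integrable_fin_num measurableT).
exact: integrable_norm.
Qed.

(** * L^4 estimates for gradients and Riesz transforms, and the bound on the balance density *)

Section estimates.
Variable R : realType.
Local Notation V := ((2 * pi) ^+ 2 : R).
Local Notation sq := (@sqint _ _ R (torus R)).
Implicit Types (a b : int * int -> R) (f : plane R -> R) (k : int * int) (N : nat).

Lemma nrm2_0 : nrm2 R 0 = 0.
Proof. by rewrite /nrm2 /= !expr0n addr0. Qed.

Lemma lap_symbol0 (p : R) : p != 0 -> lap_symbol p 0 = 0.
Proof. by move=> p0; rewrite /lap_symbol -/(nrm2 R 0) nrm2_0 powR0. Qed.

Lemma lap_symbol_ge0 (p : R) k : 0 <= lap_symbol p k.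
Proof. exact: powR_ge0. Qed.

(** Nonzero frequencies have |k| >= 1, and at k = 0 both symbols vanish because the exponents are
    nonzero. *)
Lemma lap_symbol_le (p q : R) k : p != 0 -> q != 0 -> p <= q ->
  lap_symbol p k <= lap_symbol q k.
Proof.
move=> p0 q0 pq; have [->|k0] := eqVneq k 0; first by rewrite !lap_symbol0.
by rewrite /lap_symbol ler_powR//; exact: nrm2_ge1.
Qed.

Lemma lap_symbol_sqr_le (p q : R) k : p != 0 -> q != 0 -> p <= q ->
  lap_symbol p k ^+ 2 <= lap_symbol q k ^+ 2.
Proof. by move=> p0 q0 pq; rewrite lerXn2r ?nnegrE ?lap_symbol_ge0// lap_symbol_le. Qed.

Lemma lap_symbol_half k : lap_symbol (2^-1 : R) k ^+ 2 = nrm2 R k.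
Proof. by rewrite /lap_symbol -/(nrm2 R k) -powR_mulrn ?powR_ge0// -powRrM mulVf// powRr1// nrm2_ge0. Qed.

(** The symbol of grad (-Delta)^(-1/2), the vector of Riesz transforms, has modulus 1 away from k =
    0. *)
Lemma lap_symbol_mhalf k : nrm2 R k * lap_symbol (- 2^-1 : R) k ^+ 2 = (k != 0)%:R.
Proof.
have [->|k0] := eqVneq k 0; first by rewrite nrm2_0 mul0r.
have n1 := nrm2_ge1 R k0; have n0 : 0 < nrm2 R k by rewrite (lt_le_trans ltr01).
rewrite /lap_symbol -/(nrm2 R k) -powR_mulrn ?powR_ge0// -powRrM mulNr mulVf//.
by rewrite powR_inv1 ?nrm2_ge0// mulfV// gt_eqF.
Qed.

Lemma dx_sym_sqr_le k : dx_sym R k ^+ 2 <= nrm2 R k.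
Proof. by rewrite lerDl sqr_ge0. Qed.

Lemma dy_sym_sqr_le k : dy_sym R k ^+ 2 <= nrm2 R k.
Proof. by rewrite lerDr sqr_ge0. Qed.

Lemma wenergy_le (w w' : int * int -> R) f N : (forall k, w k <= w' k) ->
  wenergy w f N <= wenergy w' f N.
Proof. by move=> ww; apply: ler_sum => k _; rewrite ler_wpM2r// coef_sq_ge0. Qed.

Lemma wsup_le (w w' : int * int -> R) f : (forall k, w k <= w' k) ->
  (wsup w f <= wsup w' f)%E.
Proof.
move=> ww; apply: ge_ereal_sup => _ [N _ <-].
apply: (@le_trans _ _ (V * wenergy w' f N)%:E); last by apply: ereal_sup_ubound; exists N.
by rewrite lee_fin ler_wpM2l ?(ltW (V_gt0 R))// wenergy_le.
Qed.

Lemma wenergy_le_wsup (w : int * int -> R) f (B : R) N : (wsup w f <= B%:E)%E ->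
  wenergy w f N <= B / V.
Proof.
move=> wB; rewrite ler_pdivlMr ?V_gt0// mulrC -lee_fin; apply: le_trans wB.
by apply: ereal_sup_ubound; exists N.
Qed.

(** The assumed energy is the Dirichlet energy of the image, so this is the embedding of H^1 into
    L^4, uniform in the symbol. As a and b vanish at 0, the same energy bounds the L^2 norm, and so
    the image exists. *)
Lemma multiplier_L4 (B : R) : exists C : R, forall a b f,
  (forall k, a (- k) = a k) -> (forall k, b (- k) = - b k) -> a 0 = 0 -> b 0 = 0 ->
  (forall N, wenergy (fun k => nrm2 R k * (a k ^+ 2 + b k ^+ 2)) f N <= B) ->
  (exists g, is_multiplier a b f g) /\
  (sq (fun x => multiplier a b f x ^+ 2)%R <= C%:E)%E.
Proof.
have [C CP] := trig_L4 B; exists C => a b f ae bo a0 b0 DB.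
have ex : exists g, is_multiplier a b f g.
  apply: (exists_multiplier ae bo (B := B)) => N; rewrite energy_mult.
  apply: le_trans (DB N); apply: wenergy_le => k.
  have [->|k0] := eqVneq k 0; first by rewrite a0 b0 nrm2_0 mul0r expr0n addr0.
  by rewrite ler_peMl ?nrm2_ge1// addr_ge0 ?sqr_ge0.
split => //; have /is_multiplierP[/in_L2P[mg sg] _] := multiplierP ex.
set c := mult_cos a b f; set s := mult_sin a b f.
apply: (@sqint_cvg_le _ _ R (torus R) (@torus_fin R) (fun n x => trig c s n x ^+ 2)) => //.
- by move=> n; apply: measurable_funX; exact: measurable_trig.
- exact: measurable_funX.
- by move=> n x; exact: sqr_ge0.
- by move=> x; exact: sqr_ge0.
- exact: sqr_multiplier_cvg.
- move=> N; exists (4 ^ N)%N; first by rewrite ltnW// ltn_expl.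
  have bt := bmfunX 4 (bmfun_trig c s (4 ^ N)).
  have cs : hermitian_coef c s := hermitian_mult f ae bo.
  have c0 : c 0 = 0 by rewrite /c /mult_cos a0 b0 !mul0r addr0.
  have s0 : s 0 = 0 by rewrite /s /mult_sin a0 b0 !mul0r subr0.
  have DB' M : dirichlet c s M <= B.
    apply: le_trans (DB M); rewrite le_eqVlt; apply/orP; left; apply/eqP.
    by apply: eq_bigr => k _; rewrite /c /s /mult_cos /mult_sin /coef_sq; ring.
  have := CP c s cs c0 s0 DB' N; rewrite -lee_fin /Rintegral fineK; last first.
    by apply: (integrable_fin_num measurableT); exact: bmfun_integrable.
  by under eq_integral => x _ do rewrite (_ : 4 = 2 * 2)%N// exprM.
Qed.

Lemma coef_sq_multiplier a b f g k : (forall k, a (- k) = a k) -> (forall k, b (- k) = - b k) ->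
  is_multiplier a b f g -> coef_sq g k = (a k ^+ 2 + b k ^+ 2) * coef_sq f k.
Proof.
move=> ae bo gP; rewrite /coef_sq (cos_coef_multiplier ae bo k gP) (sin_coef_multiplier ae bo k gP).
by rewrite /mult_cos /mult_sin; ring.
Qed.

Lemma lap_weight2 k : lap_weight (2 : R) k = nrm2 R k ^+ 2.
Proof. by rewrite /lap_weight divff// /lap_symbol -/(nrm2 R k) powRr1// nrm2_ge0. Qed.

(** H^2 controls the derivatives in H^1, since |k|^2 k_i^2 <= |k|^4. *)
Lemma gradient_L4 (B : R) : exists C : R, forall f,
  (wsup (lap_weight 2) f <= B%:E)%E ->
  gradient_exists f /\ (sq (fun x => dx f x ^+ 2)%R <= C%:E)%E /\
  (sq (fun x => dy f x ^+ 2)%R <= C%:E)%E.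
Proof.
have [C CP] := multiplier_L4 (B / V); exists C => f fB.
have le b : (forall k, b k ^+ 2 <= nrm2 R k) -> forall N,
    wenergy (fun k => nrm2 R k * ((cst 0 : int * int -> R) k ^+ 2 + b k ^+ 2)) f N <= B / V.
  move=> bk N; apply: le_trans (wenergy_le_wsup N fB); apply: wenergy_le => k.
  by rewrite lap_weight2 expr0n add0r [leRHS]expr2 ler_wpM2l ?nrm2_ge0.
have [ex hx] := CP (cst 0) (dx_sym R) f (fun=> erefl) (@dx_sym_odd R) erefl erefl (le _ dx_sym_sqr_le).
have [ey hy] := CP (cst 0) (dy_sym R) f (fun=> erefl) (@dy_sym_odd R) erefl erefl (le _ dy_sym_sqr_le).
split; first exact: (conj ex ey).
by split; [exact: hx|exact: hy].
Qed.

(* The symbol of grad (-Delta)^(-1/2) is bounded, so only the H^1 norm of f enters. *)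
Lemma riesz_gradient_L4 (B : R) : exists C : R, forall f,
  (wsup (lap_weight (3 / 2)) f <= B%:E)%E ->
  let psi := frac_lap (- 2^-1) f in
  gradient_exists psi /\ (sq (fun x => dx psi x ^+ 2)%R <= C%:E)%E /\
  (sq (fun x => dy psi x ^+ 2)%R <= C%:E)%E.
Proof.
have [C CP] := gradient_L4 B; exists C => f fB psi; apply: CP.
have z0 : (cst 0 : int * int -> R) = fun k => - (cst 0 : int * int -> R) k.
  by apply/funext => k; rewrite oppr0.
have zo k : (cst 0 : int * int -> R) (- k) = - (cst 0 : int * int -> R) k by rewrite oppr0.
have h2 : (2^-1 : R) != 0 by rewrite invr_neq0.
have h34 : (3 / 2 / 2 : R) != 0 by rewrite !mulf_neq0 ?invr_neq0.
have hm2 : (- 2^-1 : R) != 0 by rewrite oppr_eq0.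
have psiP : is_frac_lap (- 2^-1) f psi.
  apply: multiplierP; apply/(exists_multiplierE f (lap_symbol_even (- 2^-1 : R)) zo).
  apply: le_lt_trans (ltry B); apply: le_trans fB; apply: wsup_le => k.
  rewrite expr0n addr0; apply: lap_symbol_sqr_le => //; lra.
(* In the H^2 energy of psi the weight |k|^4 meets the factor |k|^-2 from its squared coefficients;
   the remaining |k|^2 is below |k|^3, the weight of H^(3/2). *)
apply: le_trans fB; apply: ge_ereal_sup => _ [N _ <-].
apply: (@le_trans _ _ (V * wenergy (lap_weight (3 / 2)) f N)%:E); last by apply: ereal_sup_ubound; exists N.
rewrite lee_fin ler_wpM2l ?(ltW (V_gt0 R))//; apply: ler_sum => k _.
rewrite (coef_sq_multiplier k (lap_symbol_even (- 2^-1 : R)) zo psiP) mulrA.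
rewrite ler_wpM2r ?coef_sq_ge0// lap_weight2 expr0n addr0 [X in X * _]expr2 -mulrA lap_symbol_mhalf.
apply: (@le_trans _ _ (nrm2 R k)).
  by rewrite ler_piMr ?nrm2_ge0// lern1 leq_b1.
by rewrite -lap_symbol_half; apply: lap_symbol_sqr_le => //; lra.
Qed.

(** M is built from the constant of [riesz_gradient_L4] at K alone. Membership in H^2 makes both
    norms finite, so that failure of [S_set] can only be the strict inequality. *)
Lemma balance_density_le (K : R) : exists2 M : R, 0 <= M & forall f : L2 R,
  spaceH 2 f -> ~ S_set K f ->
  (normH (3 / 2) f ^+ 2 + (\int[torus R]_x (grad_dot f f x
     * grad_dot f (frac_lap (- 2^-1) f) x))%:E <= M%:E)%E.
Proof.
have [C CP] := riesz_gradient_L4 K.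
exists (`|K| + (`|K| + 4 * `|C|)); first by rewrite !addr_ge0// mulr_ge0.
move=> f /spaceHE f2 nS.
have h1 : (1 : R) != 0 by rewrite oner_neq0.
have h34 : (3 / 2 / 2 : R) != 0 by rewrite !mulf_neq0 ?invr_neq0.
have s2f : wsup (lap_weight 2) f \is a fin_num.
  rewrite ge0_fin_numE//.
  apply: le_trans (_ : ((V * wenergy (lap_weight 2) f 0)%:E <= _)%E).
    rewrite lee_fin mulr_ge0 ?(ltW (V_gt0 R))//; apply: sumr_ge0 => k _.
    by rewrite mulr_ge0 ?sqr_ge0 ?coef_sq_ge0.
  by apply: ereal_sup_ubound; exists 0%N.
(* This constant depends on f; it yields finiteness and does not enter M. *)
have [C2 C2P] := gradient_L4 (fine (wsup (lap_weight 2) f)).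
have [fD [fx fy]] : gradient_exists f /\ (sq (fun x => dx f x ^+ 2)%R <= C2%:E)%E /\
  (sq (fun x => dy f x ^+ 2)%R <= C2%:E)%E by apply: C2P; rewrite fineK.
have [/in_L2_measurable mx /in_L2_measurable my] := gradient_L2 fD.
have Hfin : (normH (3 / 2) f < +oo)%E.
  rewrite -(@expe_lty _ _ 1) ?normH_ge0// normH_sqr; apply: le_lt_trans f2.
  by apply: wsup_le => k; apply: lap_symbol_sqr_le => //; rewrite ?divff//; lra.
have Wfin : (normW14 f < +oo)%E.
  rewrite -(@expe_lty _ _ 3) ?normW14_ge0// normW14_4// -sqint_grad_dot// grad_dotff.
  apply: le_lt_trans (sqintD_weighted ltr01 (measurable_funX 2 mx) (measurable_funX 2 my)) _.
  have fin u (r : R) : 0 <= r -> (sq u <= C2%:E)%E -> (r%:E * sq u < +oo)%E.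
    move=> r0 uC; apply: le_lt_trans (lee_pmul _ _ (lexx _) uC) _; rewrite ?lee_fin//.
      exact: sqint_ge0.
    by rewrite -EFinM ltry.
  apply: lte_add_pinfty; apply: fin; [|exact: fx| |exact: fy]; by rewrite addr_ge0.
have KWH : (normW14 f ^+ 4 + normH (3 / 2) f ^+ 2 < K%:E)%E.
  by rewrite ltNge; apply/negP => KWH; apply: nS.
have W0 : (0 <= normW14 f ^+ 4)%E by rewrite expe_ge0// normW14_ge0.
have H0 : (0 <= normH (3 / 2) f ^+ 2)%E by rewrite expe_ge0// normH_ge0.
have WK : (normW14 f ^+ 4 <= K%:E)%E by rewrite (le_trans _ (ltW KWH))// leeDl.
have HK : (normH (3 / 2) f ^+ 2 <= K%:E)%E by rewrite (le_trans _ (ltW KWH))// leeDr.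
have KK : K <= `|K| by exact: ler_norm.
rewrite EFinD; apply: leeD; first by rewrite (le_trans HK)// lee_fin.
rewrite normH_sqr in HK; have := CP f HK; set psi := frac_lap _ _ => -[pD [px py]].
have [/in_L2_measurable mpx /in_L2_measurable mpy] := gradient_L2 pD.
rewrite normW14_4// -sqint_grad_dot// in WK.
have qK : sq (fun x => dx f x * dx f x + dy f x * dy f x) = sq (grad_dot f f) by [].
rewrite -qK in WK; rewrite lee_fin.
apply: le_trans (ler_norm _) _.
exact: (Rintegral_quartic_le mx my mpx mpy WK px py).
Qed.

End estimates.

(** * Integration of an almost everywhere upper bound *)

Section integral_bound.
Import HBNNSimple.

(** F is an arbitrary function, so that the balance density fits: the integral of the positive part
    is a supremum over simple functions below it, each almost everywhere at most M, and the negative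
    part only lowers the value. *)
Lemma integral_le_cst_ae d (T : measurableType d) (R : realType) (mu : probability T R)
    (F : T -> \bar R) (M : R) : 0 <= M -> {ae mu, forall x, (F x <= M%:E)%E} ->
  (\int[mu]_x F x <= M%:E)%E.
Proof.
move=> M0 FM; rewrite integralE.
apply: (@le_trans _ _ (\int[mu]_x (funepos F x))%E).
  by rewrite -[leRHS]sube0; apply: leeB => //; exact: integral_ge0.
rewrite ge0_integralTE//; apply: ge_ereal_sup => _ [h /= hF <-].
rewrite -integralT_nnsfun.
have -> : M%:E = (\int[mu]_x (cst M%:E) x)%E by rewrite integral_cst// -[LHS]mule1; congr (_ * _)%E; exact/esym/probability_setT.
apply: ae_ge0_le_integral => //.
- by move=> x _; rewrite lee_fin fun_ge0.
- exact/measurable_EFinP.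
- apply: filterS FM => x FMx _; apply: le_trans (hF x) _.
  by rewrite funeposE ge_max FMx lee_fin.
Qed.

End integral_bound.

(** * Noise in a single mode, and the conclusion *)

Lemma noise_sum_single (R : realType) (lambda : nat -> R) (c s : R) :
  noise_sum lambda (fun j => if j is 0%N then c else 0) s = (lambda 0%N `^ s * c ^+ 2)%:E.
Proof.
rewrite /noise_sum; apply/cvg_lim => //; apply: cvg_near_cst; exists 1%N => // -[//|n] _ /=.
rewrite big_nat_recl// big1 ?adde0// => j _.
by rewrite expr0n mulr0.
Qed.

Theorem corollary1p3 (R : realType)
    (e : nat -> L2 R) (lambda : nat -> R)
    (d : measure_display) (Omega : measurableType d) (P : probability Omega R)
    (W : nat -> R -> Omega -> R)
    (mu_alpha : (nat -> R) -> R -> probability (borelL2 R) R)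
    (alpha_seq : (nat -> R) -> nat -> R)
    (mu : (nat -> R) -> probability (borelL2 R) R)
    (he : eigenbasis e lambda)
    (hW : brownian_motions P W)
    (hstat : forall a, (noise_sum lambda a 0 < +oo)%E ->
       forall alpha : R, 0 < alpha < 1 ->
         stationary P W e a alpha (mu_alpha a alpha) /\
         time_average_limit P W e a alpha (mu_alpha a alpha))
    (hmoment : forall a, (noise_sum lambda a 0 < +oo)%E ->
       moment_bounds (mu_alpha a))
    (hlim : forall a, (noise_sum lambda a 0 < +oo)%E ->
       inviscid_limit (alpha_seq a) (mu_alpha a) (mu a))
    (hH2 : forall a, (noise_sum lambda a 0 < +oo)%E ->
       mu a (spaceH 2) = 1%E)
    (hinv : forall a, (noise_sum lambda a 0 < +oo)%E ->
       sqg_invariant (mu a))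
    (hbal : forall a, (noise_sum lambda a 0 < +oo)%E ->
       balance lambda a (mu a))
    (K : R) :
  (exists theta0 : L2 R, S_set K theta0 /\
     exists theta : R -> L2 R, unique_global_solution theta0 theta) /\
  (exists a : nat -> R, (noise_sum lambda a 0 < +oo)%E /\
     (0 < mu a (S_set K))%E).
Proof.
have [M M0 MP] := balance_density_le K.
have lam0 : 0 < lambda 0%N by case: he => [[]].
pose L := lambda 0%N `^ (- 2^-1).
have L0 : 0 < L by exact: powR_gt0.
(* Chosen so that A_{-1/2} / 2 = L c^2 / 2 = M + 1, just beyond what the density bound allows. *)
pose c := Num.sqrt (2 * (M + 1) / L).
pose a (j : nat) := if j is 0%N then c else 0.
have aE s : noise_sum lambda a s = (lambda 0%N `^ s * c ^+ 2)%:E := noise_sum_single lambda c s.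
have a0 : (noise_sum lambda a 0 < +oo)%E by rewrite aE ltry.
have mS := measurable_S_set K; have mH := @measurable_spaceH R 2.
have Spos : (0 < mu a (S_set K))%E.
  rewrite lt_neqAle measure_ge0 andbT eq_sym; apply/negP => /eqP S0.
  have mN : measurable (S_set K `|` ~` spaceH 2 : set (borelL2 R)).
    by apply: measurableU => //; exact: measurableC.
  have N0 : mu a (S_set K `|` ~` spaceH 2) = 0%E.
    apply/eqP; rewrite eq_le measure_ge0 andbT.
    have C0 : mu a (~` spaceH 2 : set (borelL2 R)) = 0%E.
      by rewrite probability_setC// (hH2 a a0) subee.
    apply: (@le_trans _ _ (mu a (S_set K) + mu a (~` spaceH 2))%E).
      by apply: measureU2 => //; exact: measurableC.
    by rewrite S0 C0 adde0.
  have ae : {ae mu a, forall f : borelL2 R,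
      (normH (3 / 2) (f : L2 R) ^+ 2 + (\int[torus R]_x (grad_dot (f : L2 R) (f : L2 R) x
        * grad_dot (f : L2 R) (frac_lap (- 2^-1) (f : L2 R)) x))%:E <= M%:E)%E}.
    exists (S_set K `|` ~` spaceH 2); split => // f /= fM.
    have [fS|nS] := pselect (S_set K f); [by left|right => fH].
    by apply: fM; exact: MP.
  have := integral_le_cst_ae M0 ae.
  (* The balance relation turns the bound into M + 1 <= M. *)
  rewrite [X in (X <= _)%E](hbal a a0) aE -/L -EFinM lee_fin /c sqr_sqrtr; last first.
    by rewrite divr_ge0 ?(ltW L0)// mulr_ge0// addr_ge0.
  have cancel_half (l : R) : l != 0 -> l * (2 * (M + 1) / l) / 2 = M + 1 by move=> l0; field.
  rewrite cancel_half ?gt_eqF//.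
  by rewrite gerDl ler10.
split; last by exists a.
have [Phi [_ [N [mN N0 PN]] _]] := hinv a a0.
(* Otherwise S_K lies inside the null set N outside which the flow gives unique global solutions,
   against its positive measure. *)
apply: contrapT => nex.
have SN : (S_set K : set (borelL2 R)) `<=` N.
  move=> f fS; apply: PN => /= fP; apply: nex.
  by exists f; split => //; exists (Phi ^~ f).
suff : (mu a (S_set K) <= 0)%E by rewrite leNgt Spos.
by rewrite -[leRHS]N0; exact: le_measure (mem_set mS) (mem_set mN) SN.
Qed.
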